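(* Let $X$ be a compact Ptolemy space with the following two properties: (E) there is at least one Ptolemy circle in $X$; (I) for each pair of distinct points $\omega,\omega'\in X$ and every sphere $S\subset X$ between $\omega,\omega'$ there is a unique space inversion $\varphi_{\omega,\omega',S}:X\to X$ with respect to $\omega,\omega'$ and $S$. Then for every $\omega\in X$ there is a 1-Lipschitz submetry $\pi_\omega:X_\omega\to B_\omega$ with the base $B_\omega$ isometric to a Euclidean space $\mathbb{R}^k$, $k\ge1$, such that any Möbius automorphism $\varphi:X\to X$ with $\varphi(\omega)=\omega'$ induces a homothety $\overline\varphi:B_\omega\to B_{\omega'}$ with $\pi_{\omega'}\circ\varphi=\overline\varphi\circ\pi_\omega$. Moreover, the fibers of $\pi_\omega$ (called $\mathbb{K}$-lines) have the following property: ($\mathbb{K}$) given a $\mathbb{K}$-line $F\subset X_\omega$ and $x\in X_\omega\setminus F$, there is a unique Ptolemy line $l\subset X_\omega$ through $x$ that intersects $F$.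
   Context: Metrics may be extended: a metric $d$ on $X$ may have at most one infinitely remote point $\omega\in X$, with $d(x,\omega)=\infty$ for $x\ne\omega$ and $d(\omega,\omega)=0$. A quadruple $(x,y,z,u)$ is admissible if no entry occurs three or four times. Its cross-ratio triple is $\mathrm{crt}_d(x,y,z,u)=(d(x,y)d(z,u):d(x,z)d(y,u):d(x,u)d(y,z))\in\mathbb{R}P^2$, with infinite factors cancelled: $\mathrm{crt}_d(x,y,z,\infty)=(d(x,y):d(x,z):d(y,z))$, $\mathrm{crt}_d(x,y,\infty,\infty)=(0:1:1)$. Two metrics are Möbius equivalent if they have the same cross-ratio triples on admissible quadruples. A Möbius structure on $X$ is a class of pairwise Möbius equivalent metrics (the full equivalence class); a set with a Möbius structure is a Möbius space. Its topology has as basis the open balls around non-remote points and the complements of closed balls, for any metric of the structure. A map is Möbius if it is injective and preserves cross-ratio triples; a Möbius automorphism is a bijective Möbius map $X\to X$. A Ptolemy space is a Möbius space such that for every admissible $Q$ the entries of $\mathrm{crt}(Q)$ satisfy the triangle inequality. For $\omega\in X$, $X_\omega=X\setminus\{\omega\}$ is regarded as a metric space with a metric of the Möbius structure for which $\omega$ is infinitely remote (unique up to homothety). A Ptolemy circle is a subset $\sigma\subset X$ homeomorphic to $S^1$ such that $d(x,z)d(y,u)=d(x,y)d(z,u)+d(x,u)d(y,z)$ for all distinct $x,y,z,u\in\sigma$ such that $(x,z)$ separates $(y,u)$ on $\sigma$. If $\omega\in\sigma$, then $\sigma\setminus\{\omega\}\subset X_\omega$ is isometric to $\mathbb{R}$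 and is called a Ptolemy line in $X_\omega$. For distinct $\omega,\omega'$, a sphere between $\omega,\omega'$ is an equivalence class in $X\setminus\{\omega,\omega'\}$ of the relation $x\sim y\iff\mathrm{crt}(\omega,x,y,\omega')=(1:1:\ast)$. A space inversion with respect to $\omega,\omega',S$, where $S$ is a sphere between $\omega,\omega'$, is a Möbius involution $\varphi:X\to X$, $\varphi^2=\mathrm{id}$, without fixed points, such that $\varphi(\omega)=\omega'$, $\varphi(S)=S$, and $\varphi(\sigma)=\sigma$ for every Ptolemy circle $\sigma$ through $\omega,\omega'$. A map $f:M\to M'$ of metric spaces is a submetry if $f(B_r(x))=B_r(f(x))$ for every ball $B_r(x)\subset M$ of radius $r>0$ centered at $x$. *)

(* Defs.v *)
From HB Require Import structures.
From mathcomp Require Import all_boot all_order all_algebra ring lra.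
From mathcomp Require Import all_classical all_reals all_analysis.
Import Order.TTheory GRing.Theory Num.Theory.
Import numFieldNormedType.Exports.

Set Implicit Arguments.
Unset Strict Implicit.
Unset Printing Implicit Defensive.

Local Open Scope classical_set_scope.
Local Open Scope ring_scope.

Definition finite_or_one_remote (R : realType) (X : Type) (d : X -> X -> \bar R) :=
  (forall x y, d x y != +oo%E) \/
  exists w, forall x y, x <> y -> d x y = +oo%E <-> (x = w \/ y = w).

Record ext_metric (R : realType) (X : Type) := ExtMetric {
  edist :> X -> X -> \bar R ;
  edist_ge0 : forall x y, (0 <= edist x y)%E ;
  edist_eq0 : forall x y, edist x y = 0%E <-> x = y ;
  edist_sym : forall x y, edist x y = edist y x ;
  edist_triangle : forall x y z, (edist x z <= edist x y + edist y z)%E ;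
  edist_remote : finite_or_one_remote edist }.

Definition remote (R : realType) (X : Type) (d : ext_metric R X) (w : X) :=
  forall x, x <> w -> d x w = +oo%E.

Definition admissible (X : eqType) (x y z u : X) :=
  forall a, (count_mem a [:: x; y; z; u] <= 2)%N.

(* Replacing every infinite distance by 1 is exactly the cancellation of
   infinite factors: if the remote point w occurs once, each of the three
   products below contains exactly one infinite factor, and if it occurs twice,
   one product contains d w w = 0 and each of the other two contains two
   infinite factors. *)
Definition factor (R : realType) (e : \bar R) : R :=
  if e is +oo%E then 1 else fine e.

(* Homogeneous coordinates of the cross-ratio triple; points of the projective
   plane are compared by [proj_eq]. *)
Definition crt (R : realType) (X : Type) (d : ext_metric R X) (x y z u : X) :
    R * R * R :=
  (factor (d x y) * factor (d z u),
   factor (d x z) * factor (d y u),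
   factor (d x u) * factor (d y z)).

Definition proj_eq (R : realType) (p q : R * R * R) :=
  exists2 k : R, k != 0 & q = (k * p.1.1, k * p.1.2, k * p.2).

Definition moebius_equiv (R : realType) (X : eqType) (d d' : ext_metric R X) :=
  forall x y z u, admissible x y z u ->
    proj_eq (crt d x y z u) (crt d' x y z u).

Definition moebius_structure (R : realType) (X : eqType)
    (M : set (ext_metric R X)) :=
  exists d, M = [set d' | moebius_equiv d d'].

Definition moebius_base (R : realType) (X : Type) (d : ext_metric R X) :
    set (set X) :=
  [set U | exists x, exists2 r : R, 0 < r &
     (~ remote d x /\ U = [set y | (d x y < r%:E)%E]) \/
     U = ~` [set y | (d x y <= r%:E)%E]].

Definition moebius_topology (R : realType) (X : topologicalType)
    (M : set (ext_metric R X)) :=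
  forall d, M d -> basis (moebius_base d).

Definition ptolemy_space (R : realType) (X : eqType) (M : set (ext_metric R X)) :=
  forall d, M d -> forall x y z u, admissible x y z u ->
    let: (a, b, c) := crt d x y z u in [/\ a <= b + c, b <= a + c & c <= a + b].

Definition moebius_map (R : realType) (X : eqType) (M : set (ext_metric R X))
    (f : X -> X) :=
  injective f /\
  forall d, M d -> forall x y z u, admissible x y z u ->
    proj_eq (crt d x y z u) (crt d (f x) (f y) (f z) (f u)).

Definition moebius_automorphism (R : realType) (X : eqType)
    (M : set (ext_metric R X)) (f : X -> X) :=
  bijective f /\ moebius_map M f.

Definition homeomorphic (T U : topologicalType) (A : set T) (B : set U) :=
  exists (f : T -> U) (g : U -> T),
    [/\ {within A, continuous f}, {within B, continuous g},
        (forall x, A x -> B (f x) /\ g (f x) = x) &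
        (forall y, B y -> A (g y) /\ f (g y) = y)].

Definition unit_circle (R : realType) : set (R * R) :=
  [set p | p.1 ^+ 2 + p.2 ^+ 2 = 1].

Definition separates (X : topologicalType) (s : set X) (x z y u : X) :=
  ~ connected_component (s `\` [set x; z]) y u.

(* The Ptolemy equality is read off the cross-ratio triple, which takes care of
   the infinite distances when a remote point of d is one of x, y, z, u. *)
Definition ptolemy_circle (R : realType) (X : topologicalType)
    (M : set (ext_metric R X)) (s : set X) :=
  homeomorphic s (@unit_circle R) /\
  forall d, M d -> forall x y z u, s x -> s y -> s z -> s u ->
    uniq [:: x; y; z; u] -> separates s x z y u ->
    let: (a, b, c) := crt d x y z u in b = a + c.

Definition sphere_rel (R : realType) (X : eqType) (M : set (ext_metric R X))
    (w w' x y : X) :=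
  forall d, M d -> exists t : R, proj_eq (crt d w x y w') (1, 1, t).

Definition sphere_between (R : realType) (X : eqType)
    (M : set (ext_metric R X)) (w w' : X) (S : set X) :=
  exists2 x, x \notin [:: w; w'] &
    S = [set y | y \notin [:: w; w'] /\ sphere_rel M w w' x y].

Definition space_inversion (R : realType) (X : topologicalType)
    (M : set (ext_metric R X)) (w w' : X) (S : set X) (f : X -> X) :=
  [/\ moebius_map M f, involutive f, (forall x, f x <> x), f w = w' &
      f @` S = S /\
      (forall s, ptolemy_circle M s -> s w -> s w' -> f @` s = s)].

Definition punctured (R : realType) (X : choiceType) (d : ext_metric R X)
  (w : X) (dw : remote d w) : Type := {x : X | x != w}.

Section punctured.
Context (R : realType) (X : choiceType) (d : ext_metric R X) (w : X).
Hypothesis dw : remote d w.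
Local Notation Xw := (punctured dw).

HB.instance Definition _ := Choice.on Xw.

Definition pt (x : Xw) : X := sval x.

Lemma edistxx x : d x x = 0%E. Proof. exact/edist_eq0. Qed.

Lemma edist_punctured_fin (x y : Xw) : d (pt x) (pt y) \is a fin_num.
Proof.
rewrite ge0_fin_numE ?edist_ge0// ltey; apply/eqP => xy.
have xNy : pt x <> pt y by move=> e; move: xy; rewrite e edistxx.
have [/(_ (pt x) (pt y))|[w0 w0P]] := edist_remote d; first by rewrite xy eqxx.
have Nw (z : Xw) : pt z <> w by apply/eqP; exact: (svalP z).
have w0E (z : Xw) : w0 <> w -> pt z = w0.
  by move=> w0w; have [//|/esym] := (w0P _ _ (Nw z)).1 (dw (Nw z)).
have xy0 := (w0P _ _ xNy).1 xy.
have w0w : w0 <> w by case: xy0 => <-; exact: Nw.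
by apply: xNy; rewrite !w0E.
Qed.

Definition pdist (x y : Xw) : R := fine (d (pt x) (pt y)).

Lemma pdistxx x : pdist x x = 0.
Proof. by rewrite /pdist edistxx. Qed.

Lemma pdist_eq0 x y : pdist x y = 0 -> x = y.
Proof.
move=> xy; apply/val_inj/(edist_eq0 d).
by rewrite -[LHS]fineK ?edist_punctured_fin//; congr (_%:E).
Qed.

Lemma pdist_sym x y : pdist x y = pdist y x.
Proof. by rewrite /pdist edist_sym. Qed.

Lemma pdist_triangle y x z : pdist x z <= pdist x y + pdist y z.
Proof.
rewrite /pdist -fineD ?edist_punctured_fin// fine_le ?fin_numD ?edist_punctured_fin//.
exact: edist_triangle.
Qed.

HB.instance Definition _ :=
  isMetric.Build R Xw pdistxx pdist_eq0 pdist_sym pdist_triangle.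

End punctured.

Definition ptolemy_line (R : realType) (X : topologicalType)
    (M : set (ext_metric R X)) (d : ext_metric R X) (w : X) (dw : remote d w)
    (l : set (punctured dw)) :=
  exists s, [/\ ptolemy_circle M s, s w & l = @pt _ _ _ _ dw @^-1` s].

(* The library norm on row vectors is the sup norm, hence an alias carrying the
   Euclidean metric. *)
Definition euclidean (R : realType) (k : nat) : Type := 'rV[R]_k.

Section euclidean.
Context (R : realType) (k : nat).
Local Notation E := (euclidean R k).

HB.instance Definition _ := Choice.copy E 'rV[R]_k.

Definition eucl_dist (x y : E) : R :=
  Num.sqrt (\sum_(i < k) ((x : 'rV_k) 0 i - (y : 'rV_k) 0 i) ^+ 2).

Lemma eucl_distxx x : eucl_dist x x = 0.
Proof. by rewrite /eucl_dist big1 ?sqrtr0// => i _; rewrite subrr expr0n. Qed.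

Lemma eucl_dist_eq0 x y : eucl_dist x y = 0 -> x = y.
Proof.
move=> /eqP; rewrite sqrtr_eq0 => s0; apply/rowP => i; apply/eqP.
have : \sum_(i < k) ((x : 'rV_k) 0 i - (y : 'rV_k) 0 i) ^+ 2 == 0.
  by rewrite eq_le s0 sumr_ge0// => j _; rewrite sqr_ge0.
rewrite psumr_eq0 => [/allP/(_ i)|j _]; last by rewrite sqr_ge0.
by rewrite mem_index_enum sqrf_eq0 subr_eq0 => /(_ isT).
Qed.

Lemma eucl_dist_sym x y : eucl_dist x y = eucl_dist y x.
Proof. by congr Num.sqrt; apply: eq_bigr => i _; rewrite -sqrrN opprB. Qed.

Lemma cauchy_schwarz (a b : 'I_k -> R) :
  (\sum_i a i * b i) ^+ 2 <= (\sum_i a i ^+ 2) * (\sum_i b i ^+ 2).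
Proof.
set A := \sum_i a i ^+ 2; set B := \sum_i b i ^+ 2; set C := \sum_i a i * b i.
have A0 : 0 <= A by apply: sumr_ge0 => i _; rewrite sqr_ge0.
have q t s : 0 <= t ^+ 2 * A - 2 * (t * s) * C + s ^+ 2 * B.
  rewrite /A /B /C !mulr_sumr -sumrB -big_split/=; apply: sumr_ge0 => i _.
  rewrite (_ : _ + _ = (t * a i - s * b i) ^+ 2) ?sqr_ge0//; ring.
move: A0; rewrite le_eqVlt => /predU1P[A0|A0]; last first.
  by have := q C A => qCA; rewrite -(ler_pM2l A0) -subr_ge0; nra.
suff -> : C = 0 by rewrite expr0n/= -A0 mul0r.
rewrite /C big1// => i _; suff -> : a i = 0 by rewrite mul0r.
move/esym/eqP: A0; rewrite psumr_eq0 => [/allP/(_ i)|j _]; last by rewrite sqr_ge0.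
by rewrite mem_index_enum sqrf_eq0 => /(_ isT)/eqP.
Qed.

Lemma eucl_dist_triangle y x z : eucl_dist x z <= eucl_dist x y + eucl_dist y z.
Proof.
pose a i := (x : 'rV_k) 0 i - (y : 'rV_k) 0 i.
pose b i := (y : 'rV_k) 0 i - (z : 'rV_k) 0 i.
have sq0 (u : 'I_k -> R) : 0 <= \sum_i u i ^+ 2.
  by apply: sumr_ge0 => i _; rewrite sqr_ge0.
have e : \sum_i ((x : 'rV_k) 0 i - (z : 'rV_k) 0 i) ^+ 2 =
    \sum_i a i ^+ 2 + 2 * (\sum_i a i * b i) + \sum_i b i ^+ 2.
  rewrite mulr_sumr -!big_split/=; apply: eq_bigr => i _; rewrite /a /b; ring.
rewrite /eucl_dist e -/(eucl_dist x y) -/(eucl_dist y z).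
rewrite -(ler_pXn2r (n := 2)) ?nnegrE ?addr_ge0 ?sqrtr_ge0// sqr_sqrtr; last by rewrite -e sq0.
rewrite sqrrD !sqr_sqrtr// lerD2r lerD2l -[leRHS]mulr_natl ler_pM2l// -sqrtrM//.
rewrite (le_trans (ler_norm _))// -sqrtr_sqr ler_wsqrtr//.
exact: cauchy_schwarz.
Qed.

HB.instance Definition _ :=
  isMetric.Build R E eucl_distxx eucl_dist_eq0 eucl_dist_sym eucl_dist_triangle.

End euclidean.

Definition isometric (R : realType) (A B : metricType R) :=
  exists2 f : A -> B, bijective f & forall x y, mdist (f x) (f y) = mdist x y.

Definition homothety (R : realType) (A B : metricType R) (f : A -> B) :=
  bijective f /\
  exists2 c : R, 0 < c & forall x y, mdist (f x) (f y) = c * mdist x y.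

Definition lipschitz1 (R : realType) (A B : metricType R) (f : A -> B) :=
  forall x y, mdist (f x) (f y) <= mdist x y.

(* "Every ball" is read as every open and every closed ball. *)
Definition submetry (R : realType) (A B : metricType R) (f : A -> B) :=
  forall x (r : R), 0 < r ->
    f @` [set y | mdist x y < r] = [set b | mdist (f x) b < r] /\
    f @` [set y | mdist x y <= r] = [set b | mdist (f x) b <= r].

Section remote_exists.
Context (R : realType) (X : choiceType) (d : ext_metric R X) (w : X).

Let phi x y := factor (d x y).

Lemma factor_ge0 x y : 0 <= phi x y.
Proof.
by rewrite /phi; have := edist_ge0 d x y; case: (d x y) => [r||]//=.
Qed.

Lemma factor_eq0 x y : phi x y = 0 <-> x = y.
Proof.
split=> [|->]; last by rewrite /phi edistxx.
move=> xy; apply/(edist_eq0 d); move: xy; rewrite /phi.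
have := edist_ge0 d x y; case: (d x y) => [r _ /= ->||]//= _ /eqP.
by rewrite oner_eq0.
Qed.

Lemma factor_sym x y : phi x y = phi y x.
Proof. by rewrite /phi edist_sym. Qed.

Lemma factor_gt0 x y : x != y -> 0 < phi x y.
Proof.
move=> xy; rewrite lt_neqAle factor_ge0 andbT eq_sym.
by apply: contra xy => /eqP/factor_eq0 ->.
Qed.

Definition inversion_dist (x y : X) : \bar R :=
  if x == y then 0%E else if (x == w) || (y == w) then +oo%E
  else (phi x y / (phi x w * phi y w))%:E.

Let lam x : R := if x == w then 1 else (phi x w)^-1.

Let lam_neq0 x : lam x != 0.
Proof.
by rewrite /lam; case: ifPn => [_|/factor_gt0/lt0r_neq0]; rewrite ?oner_eq0 ?invr_eq0.
Qed.

Let factor_inversion x y :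
  factor (inversion_dist x y) = phi x y * lam x * lam y.
Proof.
rewrite /inversion_dist; case: eqVneq => [->|xy].
  by rewrite (factor_eq0 y y).2// !mul0r.
rewrite /lam; case: (eqVneq x w) => [xw|xw]/=.
  subst x; rewrite eq_sym (negbTE xy) (factor_sym y) mulr1 divff//.
  exact/lt0r_neq0/factor_gt0.
case: (eqVneq y w) => [yw|yw]/=; last by rewrite invfM mulrA.
by subst y; rewrite mulr1 divff//; exact/lt0r_neq0/factor_gt0.
Qed.

Hypothesis ptd : forall x y z u, admissible x y z u ->
  let: (a, b, c) := crt d x y z u in [/\ a <= b + c, b <= a + c & c <= a + b].

Let inv_ge0 x y : (0 <= inversion_dist x y)%E.
Proof.
rewrite /inversion_dist; case: ifP => // _; case: ifP => // _.
by rewrite lee_fin divr_ge0// ?mulr_ge0// factor_ge0.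
Qed.

Let inv_eq0 x y : inversion_dist x y = 0%E <-> x = y.
Proof.
split=> [|->]; last by rewrite /inversion_dist eqxx.
rewrite /inversion_dist; case: eqVneq => // xy; case: ifP => // /norP[xw yw] [].
move=> /eqP; rewrite gt_eqF// divr_gt0// ?mulr_gt0// factor_gt0//.
Qed.

Let inv_sym x y : inversion_dist x y = inversion_dist y x.
Proof.
rewrite /inversion_dist eq_sym orbC; case: ifP => // _; case: ifP => // _.
by rewrite factor_sym (mulrC (phi x w)).
Qed.

Let inv_triangle x y z :
  (inversion_dist x z <= inversion_dist x y + inversion_dist y z)%E.
Proof.
have [->|xy] := eqVneq x y; first by rewrite (inv_eq0 y y).2// add0e.
have [<-|yz] := eqVneq y z; first by rewrite (inv_eq0 y y).2// adde0.
have [<-|xz] := eqVneq x z.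
  by rewrite (inv_eq0 x x).2// adde_ge0.
rewrite {2 3}/inversion_dist (negbTE xy) (negbTE yz).
have [xw|xw] /= := eqVneq x w.
  by case: ifP => _; rewrite ?addye// leey.
have [yw|yw] /= := eqVneq y w; first by rewrite addye// leey.
have [zw|zw] /= := eqVneq z w; first by rewrite addey// leey.
rewrite /inversion_dist (negbTE xz) (negbTE xw) (negbTE zw) /=.
rewrite -EFinD lee_fin.
have adm : admissible x y z w.
  move=> a /=; rewrite addn0.
  case: (eqVneq x a) => [ax|_]; first subst a.
    by rewrite (eq_sym y) (eq_sym z) (eq_sym w) (negbTE xy) (negbTE xz) (negbTE xw).
  case: (eqVneq y a) => [ay|_]; first subst a.
    by rewrite (eq_sym z) (eq_sym w) (negbTE yz) (negbTE yw).
  by case: (z == a); case: (w == a).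
have := ptd adm; rewrite /crt -!/(phi _ _) => -[_ + _].
have px := factor_gt0 xw; have py := factor_gt0 yw; have pz := factor_gt0 zw.
move=> P.
have -> : phi x y / (phi x w * phi y w) + phi y z / (phi y w * phi z w) =
   (phi x y * phi z w + phi x w * phi y z) / (phi x w * phi y w * phi z w).
  by field; rewrite !gt_eqF.
have -> : phi x z / (phi x w * phi z w) =
   (phi x z * phi y w) / (phi x w * phi y w * phi z w).
  by field; rewrite !gt_eqF.
by rewrite ler_pM2r// invr_gt0 !mulr_gt0.
Qed.

Let inv_remote : finite_or_one_remote inversion_dist.
Proof.
right; exists w => x y /eqP xy; rewrite /inversion_dist (negbTE xy).
have [xw|xw] /= := eqVneq x w; first by split=> // _; left.
have [yw|yw] /= := eqVneq y w; first by split=> // _; right.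
by split=> // -[] /eqP; rewrite ?(negbTE xw) ?(negbTE yw).
Qed.

Definition inversion_metric : ext_metric R X :=
  ExtMetric inv_ge0 inv_eq0 inv_sym inv_triangle inv_remote.

Lemma inversion_metric_remote : remote inversion_metric w.
Proof.
by move=> x /eqP xw /=; rewrite /inversion_dist (negbTE xw) eqxx orbT.
Qed.

Lemma inversion_metric_equiv : moebius_equiv d inversion_metric.
Proof.
move=> x y z u _; exists (lam x * lam y * lam z * lam u).
  by rewrite !mulf_neq0.
rewrite /crt /= !factor_inversion -!/(phi _ _).
by congr (_, _, _); ring.
Qed.

End remote_exists.

(* Every X_w carries a metric of the Moebius structure. *)
Lemma remote_exists (R : realType) (X : choiceType) (M : set (ext_metric R X)) :
  moebius_structure M -> ptolemy_space M ->
  forall w, exists2 d, M d & remote d w.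
Proof.
move=> [d0 ->] Mpt w.
have d0d0 : moebius_equiv d0 d0.
  by move=> *; exists 1; rewrite ?oner_neq0// !mul1r.
exists (inversion_metric w (Mpt _ d0d0)).
- exact: inversion_metric_equiv.
- exact: inversion_metric_remote.
Qed.

(* Main.v *)
(** In [X_w] the space inversions yield homotheties around every point that fix
    all lines through it.  By the Ptolemy inequality distance functions are convex
    along lines, and an inversion turns the jump of the slope of a distance
    function along a line into the sum of the Busemann functions of the two ends
    of the line.  As these jumps tend to [0] along a convergent sequence and a
    line can be shifted along itself, the two Busemann functions are opposite,
    hence affine along every line.  Their slopes are symmetric, and a line is
    determined by one of its points and its Busemann function.

    Given [x] and [y], the isometry [f = h_(y,1/2) o h_(x,2)] acts on all Busemann
    functions by constants; rescaling its orbit [f^n x] around [x] converges to a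
    line through [x] along which every Busemann function attains its value at
    [y].  So the vectors of values of all Busemann functions form a vector space,
    with unit sphere the set of directions of lines and scalar product given by
    the slopes; it is finite-dimensional by local compactness.  The map [pi]
    records the Busemann functions of a maximal orthonormal family. *)

Require Import Defs.
From mathcomp Require Import all_boot all_order all_algebra ring lra.
From mathcomp Require Import all_classical all_reals all_analysis.
Import Order.TTheory GRing.Theory Num.Theory.
Import numFieldNormedType.Exports.
Local Open Scope classical_set_scope.
Local Open Scope ring_scope.

Set Implicit Arguments.
Unset Strict Implicit.
Unset Printing Implicit Defensive.

(** All limits are taken along one filter [F] on the natural numbers along which every bounded
    sequence of points converges; compactness of [X] provides it in the form of an ultrafilter. A
    limit line needs a limit point for every real parameter at once, and a common filter makes these
    choices compatible without any diagonal extraction.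

    The obstacle is that only one circle is given, so that no line through a prescribed point is
    available at the start. Such lines are limits of shrunk objects: a known line shrunk towards the
    point, or an orbit of [f] shrunk towards its origin. In the second case the speed of the limit
    is the growth rate of a subadditive sequence, and it is positive as soon as one Busemann
    function separates [x] from [y].

    Automorphisms descend to the base because the base distance is the maximum of the differences of
    Busemann functions over all lines: it depends on the metric of [X_w] only, not on the
    orthonormal family chosen. *)

(* Fekete's lemma. *)
Lemma subadditive_growth (R : realType) (a : nat -> R) :
  (forall n, 0 <= a n) -> (forall m n, a (m + n)%N <= a m + a n) ->
  exists l, [/\ 0 <= l, forall n, l * n%:R <= a n &
    forall e, 0 < e -> exists C, forall n, a n <= (l + e) * n%:R + C].
Proof.
move=> a0 aD; pose S := [set a n.+1 / n.+1%:R | n in [set: nat]].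
have pos n : 0 < n.+1%:R :> R by rewrite ltr0n.
have Slb : lbound S 0.
  by move=> _ [n _ <-]; rewrite divr_ge0// ltW.
have S0 : S !=set0 by exists (a 1%N / 1%:R), 0%N.
have a00 q : forall M, a (q * M)%N <= a 0%N + q%:R * a M.
  move=> M; elim: q => [|q IH]; first by rewrite mul0n mul0r addr0.
  by rewrite mulSn (le_trans (aD _ _))// -natr1 mulrDl mul1r; lra.
exists (inf S); split.
- by apply: lb_le_inf.
- move=> [|n]; first by rewrite mulr0.
  rewrite -ler_pdivlMr//; apply: ge_inf; first by exists 0.
  by exists n.
- move=> e e0.
  have [|_ [M _ <-] Me] := @inf_adherent _ S _ e0.
    by split=> //; exists 0.
  have aM : a M.+1 <= (inf S + e) * M.+1%:R by rewrite -ler_pdivrMr// ltW.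
  have p0 : 0 <= inf S + e.
    by have := lb_le_inf S0 Slb; lra.
  pose C := \sum_(i < M.+1) a i.
  have aC r : (r < M.+1)%N -> a r <= C.
    move=> rM; rewrite /C (bigD1 (Ordinal rM))//= lerDl.
    exact: sumr_ge0.
  exists (a 0%N + C) => n.
  rewrite {1}(divn_eq n M.+1); apply: le_trans (aD _ _) _.
  have := aC _ (ltn_pmod n (ltn0Sn M)); have := a00 (n %/ M.+1)%N M.+1.
  have : (n %/ M.+1)%:R * a M.+1 <= (inf S + e) * n%:R.
    rewrite (le_trans (ler_wpM2l _ aM))//.
    rewrite mulrCA ler_wpM2l// -natrM ler_nat; exact: leq_trunc_div.
  by lra.
Qed.

(** * Lines and Busemann functions *)

Section lines.
Context (R : realType) (Y : metricType R).
Implicit Types (g c : R -> Y) (x y : Y).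

Definition line g := forall s t, mdist (g s) (g t) = `|s - t|.

(** The infimum is a limit at infinity, as the expression does not increase with [t]. With this sign
    a Busemann function decreases at unit speed along its own line. *)
Definition busemann g x : R := inf [set mdist x (g t) - t | t in setT].

Definition line_rev g t := g (- t).

Lemma line_revP g : line g -> line (line_rev g).
Proof. by move=> lg s t; rewrite lg -opprD normrN. Qed.

Lemma line_shift g a : line g -> line (fun t => g (t + a)).
Proof. by move=> lg s t; rewrite lg opprD addrACA subrr addr0. Qed.

(** [r] is the squared radius. Nothing is asked at [o], which the underlying space inversion
    exchanges with the remote point. The sign in the last clause reflects the absence of fixed
    points: the two rays of a line through [o] are exchanged. *)
Definition is_inversion (o : Y) (r : R) (phi : Y -> Y) :=
  [/\ forall x, x != o -> phi x != o /\ mdist (phi x) o * mdist x o = r,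
      forall x y, x != o -> y != o ->
        mdist (phi x) (phi y) * (mdist x o * mdist y o) = r * mdist x y,
      forall x, x != o -> phi (phi x) = x &
      forall g, line g -> g 0 = o ->
        forall t, t != 0 -> phi (g t) = g (- r / t)].

Section one_line.
Context (g : R -> Y).
Hypothesis lg : line g.

Lemma line_mdist_anti x s t :
  s <= t -> mdist x (g t) - t <= mdist x (g s) - s.
Proof.
move=> st; have := metric_triangle x (g s) (g t); rewrite lg.
by rewrite ler0_norm ?subr_le0//; lra.
Qed.

Lemma line_mdist_lb x t : - mdist x (g 0) <= mdist x (g t) - t.
Proof.
have := metric_triangle (g 0) x (g t); rewrite lg (metric_sym (g 0)).
by have := ler_norm t; rewrite sub0r normrN; lra.
Qed.

Lemma busemann_le x t : busemann g x <= mdist x (g t) - t.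
Proof.
apply: ge_inf; last by exists t.
by exists (- mdist x (g 0)) => _ [s _ <-]; exact: line_mdist_lb.
Qed.

Lemma busemann_ge x a : (forall t, a <= mdist x (g t) - t) -> a <= busemann g x.
Proof.
move=> ax; apply: lb_le_inf; first by exists (mdist x (g 0) - 0), 0.
by move=> _ [t _ <-].
Qed.

Lemma busemann_near x e : 0 < e ->
  exists T, forall t, T <= t -> mdist x (g t) - t < busemann g x + e.
Proof.
move=> e0.
have [|_ [T _ <-] Te] := @inf_adherent _ [set mdist x (g t) - t | t in setT] e e0.
- split; first by exists (mdist x (g 0) - 0), 0.
  by exists (- mdist x (g 0)) => _ [s _ <-]; exact: line_mdist_lb.
- by exists T => t /(line_mdist_anti x) tT; exact: le_lt_trans tT Te.
Qed.

Lemma busemann_line s : busemann g (g s) = - s.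
Proof.
apply/eqP; rewrite eq_le; apply/andP; split.
  by have := busemann_le (g s) s; rewrite mdistxx sub0r.
by apply: busemann_ge => t; rewrite lg; have := ler_norm (t - s); rewrite distrC; lra.
Qed.

Lemma busemann_lip x y : busemann g x - busemann g y <= mdist x y.
Proof.
rewrite lerBlDl -lerBlDr; apply: busemann_ge => t.
by have := busemann_le x t; have := metric_triangle x y (g t); lra.
Qed.

Lemma busemann_lip_norm x y : `|busemann g x - busemann g y| <= mdist x y.
Proof.
by rewrite ler_norml lerNl opprB [leLHS]/= {1}metric_sym !busemann_lip.
Qed.

End one_line.

Lemma busemann_rev_ge0 g x : line g ->
  0 <= busemann g x + busemann (line_rev g) x.
Proof.
move=> lg; rewrite -lerBlDr sub0r; apply: busemann_ge => // s.
rewrite lerNl opprB; apply/ler_addgt0Pr => e e0.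
have [T HT] := busemann_near (line_revP lg) x e0.
have := HT (Num.max T (- s)); rewrite le_max lexx => /(_ isT).
set t := Num.max _ _; rewrite /line_rev.
have := metric_triangle (g s) x (g (- t)); rewrite lg opprK (metric_sym (g s)).
by have := ler_norm (s + t); lra.
Qed.

End lines.

Lemma busemann_scale (R : realType) (Y Y' : metricType R) (g : R -> Y)
    (g' : R -> Y') (x : Y) (x' : Y') (k : R) :
  line g -> line g' -> 0 < k ->
  (forall t, mdist x' (g' (k * t)) = k * mdist x (g t)) ->
  busemann g' x' = k * busemann g x.
Proof.
move=> lg lg' k0 e; apply/eqP; rewrite eq_le; apply/andP; split.
  rewrite -ler_pdivrMl//; apply: busemann_ge => // t.
  have := busemann_le lg' x' (k * t); rewrite e -mulrBr.
  by rewrite -ler_pdivrMl.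
apply: busemann_ge => // t; rewrite -[t](mulVKf (lt0r_neq0 k0)) e -mulrBr.
by rewrite ler_pM2l//; exact: busemann_le.
Qed.

(** * Projections to a Euclidean base whose distance is read off Busemann functions *)

Section line_fibration.
Context (R : realType) (Y : metricType R).

(** What the theorem needs from the geometry of [Y]. The third clause makes every Busemann function
    constant on the fibers; the last one is the uniqueness in property (K). *)
Record line_fibration k (pi : Y -> euclidean R k) : Prop := LineFibration {
  fibration_surj : forall b, exists x, pi x = b ;
  fibration_line : forall x y, exists c t,
    [/\ line c, c 0 = x, pi (c t) = pi y & mdist (pi x) (pi y) = `|t|] ;
  fibration_busemann : forall c x y, line c ->
    `|busemann c x - busemann c y| <= mdist (pi x) (pi y) ;
  fibration_uniq : forall c c' t t', line c -> line c' -> c 0 = c' 0 ->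
    pi (c t) = pi (c' t') -> pi (c t) <> pi (c 0) -> range c = range c' }.

Context (k : nat) (pi : Y -> euclidean R k).
Hypothesis pi_fib : line_fibration pi.

(** The Busemann function of the line from [x] to the fiber of [y] changes at unit speed along this
    line and is constant on that fiber, so it attains the bound of [fibration_busemann]. *)
Lemma fibration_busemann_eq x y :
  exists2 c, line c & `|busemann c x - busemann c y| = mdist (pi x) (pi y).
Proof.
have [c [t [lc c0 ct ->]]] := fibration_line pi_fib x y; exists c => //.
have := fibration_busemann pi_fib (c t) y lc.
rewrite ct mdistxx normr_le0 subr_eq0 => /eqP <-.
by rewrite -c0 !busemann_line// oppr0 opprK add0r.
Qed.

Lemma fibration_lipschitz1 : lipschitz1 pi.
Proof.
move=> x y; have [c lc <-] := fibration_busemann_eq x y.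
exact: busemann_lip_norm.
Qed.

Lemma fibration_submetry : submetry pi.
Proof.
have lift x b : exists2 y, pi y = b & mdist x y = mdist (pi x) b.
  have [y <-] := fibration_surj pi_fib b.
  have [c [t [lc <- ct ->]]] := fibration_line pi_fib x y.
  by exists (c t); rewrite // lc sub0r normrN.
move=> x r r0; split; apply/seteqP; split => b /=.
- by move=> [y /= xy <-]; exact: le_lt_trans (fibration_lipschitz1 x y) xy.
- by move=> xb; have [y yb e] := lift x b; exists y => //=; rewrite e.
- by move=> [y /= xy <-]; exact: le_trans (fibration_lipschitz1 x y) xy.
- by move=> xb; have [y yb e] := lift x b; exists y => //=; rewrite e.
Qed.

End line_fibration.

(** A homothety maps lines to lines, up to a change of speed, and multiplies their Busemann
    functions by its factor. As base distances are maxima over lines, they grow at least by this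
    factor; the reverse bound comes from the inverse map. *)
Lemma fibration_scale_le (R : realType) (Y Y' : metricType R) (k k' : nat)
    (pi : Y -> euclidean R k) (pi' : Y' -> euclidean R k') (f : Y -> Y') a x y :
  line_fibration pi -> line_fibration pi' -> 0 < a ->
  (forall x y, mdist (f x) (f y) = a * mdist x y) ->
  a * mdist (pi x) (pi y) <= mdist (pi' (f x)) (pi' (f y)).
Proof.
move=> pi_fib pi'_fib a0 fd; have [c lc <-] := fibration_busemann_eq pi_fib x y.
have lfc : line (fun t => f (c (t / a))).
  move=> s t; rewrite fd lc -mulrBl normrM normfV (gtr0_norm a0).
  by field; rewrite gt_eqF.
apply: le_trans (fibration_busemann pi'_fib _ _ lfc).
have E z : busemann (fun t => f (c (t / a))) (f z) = a * busemann c z.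
  apply: busemann_scale => // t; by rewrite fd [a * t]mulrC mulfK// gt_eqF.
by rewrite !E -mulrBr normrM (gtr0_norm a0).
Qed.

Section fibration_homothety.
Context (R : realType) (Y Y' : metricType R) (k k' : nat).
Context (pi : Y -> euclidean R k) (pi' : Y' -> euclidean R k').
Hypotheses (pi_fib : line_fibration pi) (pi'_fib : line_fibration pi').

Lemma fibration_homothety (f : Y -> Y') (f' : Y' -> Y) a : 0 < a ->
  cancel f f' -> cancel f' f -> (forall x y, mdist (f x) (f y) = a * mdist x y) ->
  exists2 h : euclidean R k -> euclidean R k', homothety h &
    forall x, pi' (f x) = h (pi x).
Proof.
move=> a0 fK f'K fd; have an0 := lt0r_neq0 a0.
have fd' x y : mdist (f' x) (f' y) = a^-1 * mdist x y.
  by rewrite -{2}(f'K x) -{2}(f'K y) fd mulKf.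
have [s sK] := choice (fibration_surj pi_fib).
have [s' s'K] := choice (fibration_surj pi'_fib).
have scale x y : mdist (pi' (f x)) (pi' (f y)) = a * mdist (pi x) (pi y).
  apply/eqP; rewrite eq_le (fibration_scale_le _ _ pi_fib pi'_fib a0 fd) andbT -ler_pdivrMl//.
  have := fibration_scale_le (f x) (f y) pi'_fib pi_fib _ fd'.
  by rewrite !fK invr_gt0; exact.
pose h b := pi' (f (s b)).
have hE x : pi' (f x) = h (pi x).
  by apply: mdist_positivity; rewrite scale sK mdistxx mulr0.
exists h => //; split; last first.
  exists a => // b b'; by rewrite /h scale !sK.
exists (fun b' => pi (f' (s' b'))) => b.
- apply: mdist_positivity; apply: (mulfI an0); rewrite mulr0.
  by rewrite -{2}(sK b) -scale f'K s'K mdistxx.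
- by rewrite -hE f'K s'K.
Qed.

End fibration_homothety.

(** * Ptolemaic spaces with inversions *)

Section ptolemaic.
Context (R : realType) (Y : metricType R) (F : set_system nat).
Context {FF : ProperFilter F}.
Hypothesis F_oo : F --> \oo.
Hypothesis bounded_cvg : forall (u : nat -> Y) p C,
  (forall n, mdist p (u n) <= C) -> exists q : Y, u @ F --> q.
Hypothesis ptolemy : forall x y z u : Y,
  mdist x z * mdist y u <= mdist x y * mdist z u + mdist x u * mdist y z.
Hypothesis inversion : forall (o : Y) (r : R), 0 < r ->
  exists phi : Y -> Y, is_inversion o r phi.
Implicit Types (g c : R -> Y) (x y : Y).

Lemma cvg_mdist (u v : nat -> Y) p q : u @ F --> p -> v @ F --> q ->
  mdist (u n) (v n) @[n --> F] --> mdist p q.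
Proof.
move=> up vq; apply/cvgrPdist_lt => e e0; near=> n.
have : mdist p (u n) < e / 2.
  by near: n; apply: metricType_numDomainType.cvgr_dist_lt => //; rewrite divr_gt0.
have : mdist q (v n) < e / 2.
  by near: n; apply: metricType_numDomainType.cvgr_dist_lt => //; rewrite divr_gt0.
have := metric_triangle p (u n) q; have := metric_triangle (u n) (v n) q.
have := metric_triangle (u n) p (v n); have := metric_triangle p q (v n).
rewrite (metric_sym (u n) p) (metric_sym (v n) q) => *.
by rewrite ltr_norml; apply/andP; split; lra.
Unshelve. all: by end_near. Qed.

Lemma cvg_busemann g (u : nat -> Y) p : line g -> u @ F --> p ->
  busemann g (u n) @[n --> F] --> busemann g p.
Proof.
move=> lg up; apply/cvgrPdist_lt => e e0; near=> n.
apply: le_lt_trans (busemann_lip_norm lg _ _) _; near: n.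
exact: metricType_numDomainType.cvgr_dist_lt.
Unshelve. all: by end_near. Qed.

Lemma line_inj g : line g -> injective g.
Proof.
move=> lg s t gst; apply/eqP; rewrite -subr_eq0 -normr_eq0 -lg gst.
by rewrite mdistxx.
Qed.

Lemma line_neq g s t : line g -> s != t -> g s != g t.
Proof. by move=> lg; rewrite (inj_eq (line_inj lg)). Qed.

Lemma line_lt g s t : line g -> s < t -> mdist (g s) (g t) = t - s.
Proof. by move=> lg st; rewrite lg distrC gtr0_norm// subr_gt0. Qed.

(** The Ptolemy inequality for [c p], [c q], [c r], [g t] is the convexity along [c] of the distance
    to [g t], and convexity survives the limit in [t]. *)
Lemma busemann_convex g c p q r : line g -> line c -> p < q -> q < r ->
  busemann g (c q) * (r - p) <=
  busemann g (c p) * (r - q) + busemann g (c r) * (q - p).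
Proof.
move=> lg lc pq qr; apply/ler_addgt0Pr => e e0.
have d0 : 0 < r - p by lra.
have e'0 : 0 < e / (r - p) by rewrite divr_gt0.
have [T1 H1] := busemann_near lg (c p) e'0.
have [T2 H2] := busemann_near lg (c r) e'0.
pose t := Num.max T1 T2.
have /ltW := H1 t (ltac:(by rewrite le_max lexx)).
have /ltW := H2 t (ltac:(by rewrite le_max lexx orbT)).
have := busemann_le lg (c q) t.
have := ptolemy (c p) (c q) (c r) (g t).
rewrite !line_lt//; last exact: lt_trans qr.
set A := mdist (c p) (g t); set B := mdist (c q) (g t); set C := mdist (c r) (g t).
move=> P1 P2.
rewrite -(ler_pM2r (_ : 0 < q - p)) ?subr_gt0// => P3.
rewrite -(ler_pM2r (_ : 0 < r - q)) ?subr_gt0// => P4.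
rewrite -(ler_pM2r d0) in P2.
have ee : e / (r - p) * (q - p) + e / (r - p) * (r - q) = e.
  by field; rewrite gt_eqF.
by move: ee P3 P4; rewrite !mulrDl; set E := e / _; lra.
Qed.

(** * Homotheties and shifts made of inversions *)

(** Two inversions about [o], of squared radii [1] and [k], are composed; on lines through [o] their
    signs cancel. The value at [o] is set by hand. *)
Lemma homothety_at (o : Y) k : 0 < k -> exists h h' : Y -> Y,
  [/\ cancel h h', cancel h' h, h o = o,
      forall x y, mdist (h x) (h y) = k * mdist x y &
      forall g, line g -> g 0 = o -> forall t, h (g t) = g (k * t)].
Proof.
move=> k0.
have [f [fo fd ff fl]] := inversion o ltr01.
have [f' [fo' fd' ff' fl']] := inversion o k0.
have dn x : x != o -> mdist x o != 0 by rewrite -mdist_gt0 => /gt_eqF->.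
pose h x := if x == o then o else f' (f x).
pose h' x := if x == o then o else f (f' x).
exists h, h'; split.
- move=> x; rewrite /h'/h; case: (eqVneq x o) => [->|xo]; first by rewrite eqxx.
  by rewrite (negbTE (fo' _ (fo _ xo).1).1) ff' ?ff//; exact: (fo _ xo).1.
- move=> x; rewrite /h'/h; case: (eqVneq x o) => [->|xo]; first by rewrite eqxx.
  by rewrite (negbTE (fo _ (fo' _ xo).1).1) ff ?ff'//; exact: (fo' _ xo).1.
- by rewrite /h eqxx.
- have H x : x != o -> mdist (f' (f x)) o = k * mdist x o.
    move=> xo; have [fxo e1] := fo _ xo; have [_ e2] := fo' _ fxo.
    apply: (mulIf (dn _ fxo)); rewrite e2 -mulrA (mulrC (mdist x o)).
    by rewrite e1 mulr1.
  move=> x y; rewrite /h; case: (eqVneq x o) => [->|xo].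
    case: (eqVneq y o) => [->|yo]; first by rewrite mdistxx mulr0.
    by rewrite metric_sym H// metric_sym.
  case: (eqVneq y o) => [->|yo]; first exact: H.
  have [fxo ex] := fo _ xo; have [fyo ey] := fo _ yo.
  have := fd' _ _ fxo fyo; have := fd _ _ xo yo; rewrite mul1r.
  have nz := mulf_neq0 (dn _ fxo) (dn _ fyo).
  move=> e1 e2; apply: (mulIf nz); rewrite e2 -e1.
  move: ex ey; set a := mdist _ _; set b := mdist _ _ => ab.
  set a' := mdist _ _; set b' := mdist _ _ => ab'.
  transitivity (k * mdist (f x) (f y) * (a * b) * (a' * b')); last by ring.
  by rewrite ab ab' !mulr1.
- move=> g lg g0 t; rewrite /h; have [->|t0] := eqVneq t 0.
    by rewrite mulr0 g0 eqxx.
  rewrite -g0 (negbTE (line_neq lg t0)) fl// fl'//; last first.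
    by rewrite mulf_neq0 ?invr_eq0// oppr_eq0 oner_eq0.
  by congr g; field; rewrite t0.
Qed.

(** The homothety of factor 2 about [g 0] is followed by that of factor 1/2 about [g (t + t)]. The
    parameter [s] becomes [2 * s], then [2 * t + (2 * s - 2 * t) / 2 = s + t]. *)
Lemma shift_along g t : line g -> exists h : Y -> Y,
  (forall x y, mdist (h x) (h y) = mdist x y) /\ forall s, h (g s) = g (s + t).
Proof.
move=> lg; have [h1 [_ [_ _ _ d1 l1]]] := homothety_at (g 0) (ltr0Sn R 1).
have half0 : 0 < 2^-1 :> R by rewrite invr_gt0 ltr0n.
have [h2 [_ [_ _ _ d2 l2]]] := homothety_at (g (t + t)) half0.
exists (h2 \o h1); split=> [x y|s] /=.
  by rewrite d2 d1; lra.
rewrite l1// -[2 * s](subrK (t + t)).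
rewrite (l2 (fun u => g (u + (t + t)))) ?add0r//; last exact: line_shift.
by congr g; lra.
Qed.

Lemma busemann_ext g x y : (forall t, mdist x (g t) = mdist y (g t)) ->
  busemann g x = busemann g y.
Proof.
move=> e; rewrite /busemann; congr (inf (_ @` _)).
by apply/funext => t; rewrite e.
Qed.

Lemma cvg_line g (u : nat -> R) s : line g -> u @ F --> s ->
  g (u n) @[n --> F] --> g s.
Proof.
move=> lg us; apply/metricType_numDomainType.cvgrPdist_lt => e e0.
by near=> n; rewrite lg; near: n; move/cvgrPdist_lt: us; exact.
Unshelve. all: by end_near. Qed.

Lemma cvg_F (T : topologicalType) (u : nat -> T) (l : T) : u @ \oo --> l -> u @ F --> l.
Proof. by move=> ul; apply: cvg_trans ul; exact: cvg_app F_oo. Qed.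

(* With [f u := |y g u|] for [y := phi y0], the inversion [phi] turns the defect
   [busemann g y0 + busemann (line_rev g) y0] into the jump of the slope of [f]
   at [0].  Translating along [g] moves [y] to points [v n] whose jumps are those
   of [f] at [1 / (n + 1)], hence tend to [0]; a limit point of [v n] has the
   same distances to [g] as [y]. *)
Lemma busemann_flat g y0 : line g -> busemann (line_rev g) y0 = - busemann g y0.
Proof.
move=> lg; have lr := line_revP lg; set o := g 0.
have [->|y0o] := eqVneq y0 o.
  have -> : busemann g o = 0 by rewrite busemann_line// oppr0.
  have -> : o = line_rev g 0 by rewrite /line_rev oppr0.
  by rewrite busemann_line.
have [phi [phio phid phiK phil]] := inversion o ltr01.
pose y := phi y0; have yo : y != o := (phio _ y0o).1.
have yE : phi y = y0 by rewrite /y phiK.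
have phig x s : x != o -> s != 0 ->
    mdist (phi x) (g s) * mdist x o = `|s| * mdist x (g (- s^-1)).
  move=> xo s0; have s'0 : - s^-1 != 0 by rewrite oppr_eq0 invr_eq0.
  have := phid x (g (- s^-1)) xo (line_neq lg s'0).
  rewrite mul1r => <-; rewrite phil// lg subr0 normrN normfV.
  have -> : -1 / - s^-1 = s by field; rewrite s0.
  by field; rewrite normr_eq0.
pose beta x := busemann g x + busemann (line_rev g) x.
pose f u := mdist y (g u).
have f0 : 0 < f 0 by rewrite mdist_gt0.
pose t n : R := (n.+1%:R)^-1.
have t0 n : 0 < t n by rewrite invr_gt0 ltr0n.
have tF : t @ F --> 0 by exact/cvg_F/cvg_harmonic.
have /choice[v vE] : forall n, exists x, forall s, mdist x (g s) = f (s + t n).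
  move=> n; have [h [dh hg]] := shift_along (- t n) lg.
  exists (h y) => s; rewrite -[LHS](_ : mdist (h y) (h (g (s + t n))) = _).
    by rewrite dh.
  by rewrite hg addrK.
have [z vz] : exists z : Y, v @ F --> z.
  apply: (bounded_cvg (p := o) (C := f 0 + 1)) => n; rewrite metric_sym vE add0r.
  have := metric_triangle y (g 0) (g (t n)); rewrite lg sub0r normrN gtr0_norm//.
  by move/le_trans; apply; rewrite lerD2l invf_le1// ler1n.
have fF s : f (s + t n) @[n --> F] --> f s.
  apply: cvg_mdist; first exact: cvg_cst.
  apply: cvg_line => //; rewrite -[X in _ --> X]addr0.
  by apply: cvgD => //; exact: cvg_cst.
have zE s : mdist z (g s) = f s.
  apply: (cvg_unique _ _ (fF s)) => //.
  rewrite (_ : (fun n => _) = (fun n => mdist (v n) (g s))); last first.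
    by apply/funext => n; rewrite vE.
  by apply: cvg_mdist => //; exact: cvg_cst.
have zo : z != o by rewrite -mdist_gt0 zE.
have f0F : f (t n) @[n --> F] --> f 0.
  by move: (fF 0); under eq_fun do rewrite add0r.
have ft0 : \forall n \near F, f 0 / 2 < f (t n).
  by apply: (cvgr_gt _ f0F); lra.
(* Continuity of [phi] along [v] is read off the distance formula of inversions, whose denominators
   stay away from [0] by [ft0]. *)
have phiv : phi (v n) @[n --> F] --> phi z.
  have dv : mdist z (v n) @[n --> F] --> (0 : R).
    by rewrite -(mdistxx z); apply: cvg_mdist => //; exact: cvg_cst.
  apply/metricType_numDomainType.cvgrPdist_lt => e e0; near=> n.
  have fn : f 0 / 2 < f (t n) by near: n.
  have vo : v n != o by rewrite -mdist_gt0 vE add0r; lra.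
  have := phid _ _ zo vo; rewrite zE vE add0r mul1r => E1.
  have : mdist z (v n) < e * (f 0 * (f 0 / 2)).
    near: n; apply: (cvgr_lt _ dv); rewrite !mulr_gt0// invr_gt0; lra.
  rewrite -E1 => H; rewrite -(ltr_pM2r (_ : 0 < f 0 * f (t n))); last by nra.
  apply: lt_le_trans H _; rewrite ler_pM2l// ler_pM2l//; lra.
have betaF : beta (phi (v n)) @[n --> F] --> beta (phi z).
  by apply: cvgD; exact: cvg_busemann.
have phiE x s : x != o -> (forall s, mdist x (g s) = f s) ->
    mdist (phi x) (g s) = mdist y0 (g s).
  move=> xo xE; rewrite -yE; have [->|s0] := eqVneq s 0.
    apply: (mulIf (lt0r_neq0 f0)).
    by rewrite -{1}xE (phio _ xo).2 (phio _ yo).2.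
  apply: (mulIf (lt0r_neq0 f0)).
  by rewrite -{1}xE phig// phig// xE.
have E : beta (phi z) = beta y0.
  by rewrite /beta; congr (_ + _); apply: busemann_ext => s; exact: phiE.
suff : beta (phi z) <= 0.
  by have := busemann_rev_ge0 y0 lg; rewrite E /beta; lra.
have eE s : s != 0 -> mdist y0 (g (- s)) * f 0 = `|s| * f s^-1.
  by move=> s0; rewrite -yE phig ?oppr_eq0// normrN invrN opprK.
apply/ler_addgt0Pr => e e0; rewrite add0r.
(* The tolerance is [e / 4]. Below, [C] and [D] are the distances from [y0] to [g (- s)] and
   [g (- (s / 2))]; both approximate the Busemann function of [line_rev g], so that
   [s + 2 * D - 2 * C] is at most [e / 2]. The bound on [T * 2] makes [s / 2] large enough for
   this. *)
have [T HT] := busemann_near lr y0 (divr_gt0 e0 (ltr0Sn R 3)).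
have eT : \forall n \near F, T * 2 <= (n.+1)%:R :> R.
  near=> n; rewrite (@le_trans _ _ n%:R) ?ler_nat//; near: n.
  by apply: F_oo; exact: nbhs_infty_ger.
have bF : \forall n \near F, beta (phi (v n)) <= e.
  near=> n; have fn : f 0 / 2 < f (t n) by near: n.
  have Tn : T * 2 <= (n.+1)%:R :> R by near: n.
  have vo : v n != o by rewrite -mdist_gt0 vE add0r; lra.
  set s : R := n.+1%:R; have s0 : 0 < s by rewrite ltr0n.
  have b1 := busemann_le lg (phi (v n)) s.
  have b2 := busemann_le lr (phi (v n)) s.
  have p1 := phig (v n) s vo (lt0r_neq0 s0).
  have p2 := phig (v n) (- s) vo (ltac:(by rewrite oppr_eq0 gt_eqF)).
  move: p1 p2 b1 b2; rewrite normrN invrN opprK !vE add0r addNr gtr0_norm//.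
  have e1 := eE s (lt0r_neq0 s0); have e2 := eE (s / 2) (ltac:(rewrite gt_eqF//; lra)).
  have E1 := HT (s / 2) (ltac:(lra)); have E2 := busemann_le lr y0 s.
  move: e1 e2 E1 E2; rewrite /line_rev invfM invrK !gtr0_norm//; last by lra.
  rewrite -/(t n) (_ : t n * 2 = t n + t n); last by lra.
  rewrite /beta; move: (f (t n)) (f (t n + t n)) fn => F1 F2.
  set A := mdist (phi _) _; set B := mdist (phi _) _.
  set C := mdist y0 _; set D := mdist y0 _.
  rewrite -/(line_rev g) => fn C1 D1 D2 C2 A1 B1 b1 b2.
  have F10 : 0 < F1 by lra.
  suff : (A + B - 2 * s) * F1 <= e * F1 by rewrite ler_pM2r//; lra.
  (* Both sides are [s] times the second difference [f 0 - 2 * F1 + F2] of [f] at [0], [1 / s],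
     [2 / s]. *)
  have -> : (A + B - 2 * s) * F1 = f 0 * (s + 2 * D - 2 * C).
    by rewrite mulrBl mulrDl A1 B1; lra.
  have : f 0 * (s + 2 * D - 2 * C) <= f 0 * (e / 2) by rewrite ler_pM2l//; lra.
  have : e * (f 0 / 2) < e * F1 by rewrite ltr_pM2l; lra.
  by lra.
exact: cvgr_to_le betaF bF.
Unshelve. all: by end_near. Qed.

Lemma cvg_eq (u : nat -> R) (a b : R) : u @ F --> a -> u @ F --> b -> a = b.
Proof. by move=> ua ub; exact: (cvg_unique (@Rhausdorff R) ua ub). Qed.

(** * Slopes of Busemann functions along lines *)

Definition slope g c := busemann g (c 1) - busemann g (c 0).

Lemma busemann_affine g c s : line g -> line c ->
  busemann g (c s) = busemann g (c 0) + slope g c * s.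
Proof.
move=> lg lc.
have aff p q r : p < q -> q < r -> busemann g (c q) * (r - p) =
    busemann g (c p) * (r - q) + busemann g (c r) * (q - p).
  move=> pq qr; apply/eqP; rewrite eq_le busemann_convex//=.
  have := busemann_convex (line_revP lg) lc pq qr.
  by rewrite !busemann_flat// !mulNr; lra.
rewrite /slope; have [s0|s0|->] := ltgtP s 0; last by rewrite mulr0 addr0.
  by have := aff _ _ _ s0 ltr01; lra.
have [s1|s1|->] := ltgtP s 1; last by rewrite mulr1 addrC subrK.
  by have := aff _ _ _ s0 s1; lra.
by have := aff _ _ _ ltr01 s1; lra.
Qed.

Lemma slope_line g : line g -> slope g g = - 1.
Proof. by move=> lg; rewrite /slope !busemann_line// opprK addr0. Qed.

(** Homotheties about the common point carry [g t] and [c t] together to every parameter of the sign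
    of [t]; the inversion of squared radius [t ^+ 2] carries them to the parameter [- t]. *)
Lemma eq_line g c t : line g -> line c -> g 0 = c 0 -> t != 0 -> g t = c t ->
  g = c.
Proof.
move=> lg lc gc0 t0 gct.
have pos k : 0 < k -> g (k * t) = c (k * t).
  move=> k0; have [h [_ [_ _ _ _ hl]]] := homothety_at (g 0) k0.
  by rewrite -!hl// gct.
have neg : g (- t) = c (- t).
  have t2 : 0 < t ^+ 2 by rewrite exprn_even_gt0.
  have [phi [_ _ _ phil]] := inversion (g 0) t2.
  have -> : - t = - t ^+ 2 / t by field.
  by rewrite -!phil// gct.
apply/funext => s; have [->//|s0] := eqVneq s 0.
have -> : s = s / t * t by field.
have [st|st] : 0 < s / t \/ 0 < - s / t.
- have : s / t != 0 by rewrite mulf_neq0 ?invr_eq0.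
  by rewrite neq_lt mulNr oppr_gt0 => /orP[]; [right|left].
- exact: pos.
- have [h [_ [_ _ _ _ hl]]] := homothety_at (g 0) st.
  have -> : s / t * t = - s / t * - t by field.
  by rewrite -!hl// neg.
Qed.

Lemma busemann_ge_pos g x a : line g ->
  (forall t, 0 < t -> a <= mdist x (g t) - t) -> a <= busemann g x.
Proof.
move=> lg ax; apply: busemann_ge => // t.
have [/ax//|t0] := ltP 0 t; apply: le_trans (ax 1 ltr01) _.
by apply: line_mdist_anti => //; lra.
Qed.

Lemma busemann_ext_pos g g' x x' : line g -> line g' ->
  (forall t, 0 < t -> mdist x (g t) = mdist x' (g' t)) ->
  busemann g x = busemann g' x'.
Proof.
move=> lg lg' e; apply/eqP; rewrite eq_le; apply/andP.
split; apply: busemann_ge_pos => // t t0; [rewrite -e|rewrite e] => //;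
  exact: busemann_le.
Qed.

(** The inversion of squared radius [t] about the common point maps [c 1] to [c (- t)] and [g t] to
    [g (- 1)] and keeps the distance of these two points. For large [t] the distance on one side
    gives the Busemann function of [g] at [c 1], on the other that of the reversed [c] at
    [g (- 1)]. *)
Lemma slope_sym0 g c : line g -> line c -> g 0 = c 0 -> slope g c = slope c g.
Proof.
move=> lg lc gc0.
have b0 : busemann g (c 0) = 0 by rewrite -gc0 busemann_line// oppr0.
have b0' : busemann c (g 0) = 0 by rewrite gc0 busemann_line// oppr0.
have -> : slope c g = - busemann c (g (- 1)).
  by rewrite busemann_affine// b0'; lra.
rewrite -busemann_flat// /slope b0 subr0.
apply: busemann_ext_pos => // [|t t0]; first exact: line_revP.
have [phi [_ phid _ phil]] := inversion (g 0) t0.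
have nz := lt0r_neq0 t0.
have := phid (c 1) (g t).
rewrite {1}gc0 !line_neq ?oner_eq0// => /(_ isT isT).
rewrite phil// phil// divr1 {1}gc0 !lc lg !subr0 normr1 mul1r gtr0_norm//.
rewrite (mulrC t) => /(mulIf nz) <-.
by rewrite metric_sym /line_rev; congr (mdist (g _) _); field.
Qed.

(** A slope [- 1] is extremal for the Lipschitz bound, which then compares the two functions in one
    direction. Reversing both lines changes their signs and gives the other direction. *)
Lemma slope_N1_busemann g c x : line g -> line c -> slope g c = - 1 ->
  busemann g x = busemann c x + busemann g (c 0).
Proof.
move=> lg lc gc; have [lg' lc'] := (line_revP lg, line_revP lc).
apply/eqP; rewrite eq_le; apply/andP; split.
  rewrite -lerBlDr; apply: busemann_ge => // t.
  have := busemann_lip lg x (c t); rewrite busemann_affine// gc; lra.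
suff : - busemann g x + busemann g (c 0) <= busemann (line_rev c) x.
  by rewrite busemann_flat//; lra.
apply: busemann_ge => // t; have := busemann_lip lg' x (c (- t)).
by rewrite !busemann_flat// busemann_affine// gc /line_rev; lra.
Qed.

(** The extremal slope forces additivity of distances across the common point, so following [g]
    before it and [c] after it is again a line [k]. As [k] shares two points with each of [g] and
    [c], it equals both. *)
Lemma slope_N1_eq g c : line g -> line c -> g 0 = c 0 -> slope g c = - 1 -> g = c.
Proof.
move=> lg lc gc0 gc.
pose k t := if t <= 0 then g t else c t.
have mix s t : s <= 0 -> 0 < t -> mdist (g s) (c t) = t - s.
  move=> s0 t0; apply/eqP; rewrite eq_le; apply/andP; split.
    have := metric_triangle (g s) (g 0) (c t); rewrite {2}gc0 lg lc.
    by rewrite subr0 sub0r normrN (gtr0_norm t0) (ler0_norm s0) addrC.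
  have := busemann_lip lg (g s) (c t).
  by rewrite busemann_line// busemann_affine// gc -gc0 busemann_line//; lra.
have lk : line k.
  move=> s t; rewrite /k; case: (leP s 0) => s0; case: (leP t 0) => t0 //.
  - by rewrite mix// distrC ger0_norm//; lra.
  - by rewrite metric_sym mix// ger0_norm//; lra.
have k0 : k 0 = g 0 by rewrite /k lexx.
have N10 : - 1 != 0 :> R by rewrite oppr_eq0 oner_eq0.
rewrite -(@eq_line k g (-1)) //; last by rewrite /k lerN10.
apply: (@eq_line _ _ 1) => //; rewrite ?oner_eq0// ?k0//.
by rewrite /k ler10.
Qed.

Lemma homothety_busemann0 o k h g x : 0 < k ->
  (forall x y, mdist (h x) (h y) = k * mdist x y) ->
  (forall g, line g -> g 0 = o -> forall t, h (g t) = g (k * t)) ->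
  line g -> g 0 = o -> busemann g (h x) = k * busemann g x.
Proof.
move=> k0 hd hl lg g0; apply: busemann_scale => // t.
by rewrite -hl// hd.
Qed.

(** * Parallel lines and translations *)

(** [c] is shrunk towards [o] by the factor [t n] and run faster to keep unit speed. Homotheties
    about [o] scale the Busemann functions of lines through [o], so slopes survive in the limit [g].
    For [g] itself this reads [slope g c = - 1], and its Busemann function differs from that of [c]
    by a constant. *)
Lemma parallel_through o c : line c -> exists g,
  [/\ line g, g 0 = o, exists a, forall x, busemann g x = busemann c x + a &
      forall k, line k -> k 0 = o -> slope k g = slope k c].
Proof.
move=> lc; pose t n : R := (n.+1%:R)^-1.
have t0 n : 0 < t n by rewrite invr_gt0 ltr0n.
have tF : t @ F --> 0 by exact/cvg_F/cvg_harmonic.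
have tK n : t n * n.+1%:R = 1 by rewrite mulVf// pnatr_eq0.
have tle1 n : t n <= 1 by rewrite invf_le1// ler1n.
have /choice[h hP] : forall n, exists h : Y -> Y, [/\ h o = o,
    forall x y, mdist (h x) (h y) = t n * mdist x y &
    forall g, line g -> g 0 = o -> forall s, h (g s) = g (t n * s)].
  by move=> n; have [h [_ [_ _ ? ? ?]]] := homothety_at o (t0 n); exists h.
pose v s n := h n (c (n.+1%:R * s)).
have vd s s' n : mdist (v s n) (v s' n) = `|s - s'|.
  rewrite /v; have [_ -> _] := hP n; rewrite lc -mulrBr normrM ger0_norm//.
  by rewrite mulrA tK mul1r.
have vo s n : mdist o (v s n) <= mdist o (c 0) + `|s|.
  apply: le_trans (metric_triangle _ (v 0 n) _) _; rewrite vd sub0r normrN lerD2r.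
  rewrite /v mulr0; have [ho hd _] := hP n; rewrite -{1}ho hd.
  by rewrite ler_piMl// mdist_ge0.
have /choice[g gF] : forall s, exists q : Y, v s @ F --> q.
  by move=> s; exact: bounded_cvg (vo s).
have lg : line g.
  move=> s s'; apply: (cvg_eq (cvg_mdist (gF s) (gF s'))) => //.
  by under eq_fun do rewrite vd; exact: cvg_cst.
have g0 : g 0 = o.
  apply: mdist_positivity.
  apply: (cvg_eq (cvg_mdist (gF 0) (cvg_cst o))) => //.
  rewrite (_ : (fun n => _) = (fun n => t n * mdist (c 0) o)); last first.
    by apply/funext => n; rewrite /v mulr0; have [ho hd _] := hP n; rewrite -{1}ho hd.
  by rewrite -[X in _ --> X](mul0r (mdist (c 0) o)); apply: (cvgM tF); exact: cvg_cst.
have gk k s : line k -> k 0 = o -> busemann k (g s) = slope k c * s.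
  move=> lk k0; apply: (cvg_eq (cvg_busemann lk (gF s))) => //.
  rewrite [X in X @ _](_ : _ = fun n => t n * busemann k (c 0) + slope k c * s).
    rewrite -[X in _ --> X]add0r -[X in _ --> X + _](mul0r (busemann k (c 0))).
    by apply: cvgD; [apply: (cvgM tF)|]; exact: cvg_cst.
  apply/funext => n; rewrite /v; have [_ hd hl] := hP n.
  rewrite (homothety_busemann0 _ (t0 n) hd hl)// busemann_affine//.
  by rewrite mulrDr mulrCA (mulrA (t n)) tK mul1r.
have sk k : line k -> k 0 = o -> slope k g = slope k c.
  by move=> lk k0; rewrite {1}/slope !gk// mulr1 mulr0 subr0.
exists g; split => //; exists (busemann g (c 0)) => x.
by apply: slope_N1_busemann => //; rewrite -sk// slope_line.
Qed.

Lemma slope_shift g g' c a : (forall x, busemann g x = busemann g' x + a) ->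
  slope g c = slope g' c.
Proof. by move=> e; rewrite /slope !e; lra. Qed.

Lemma slope_sym g c : line g -> line c -> slope g c = slope c g.
Proof.
move=> lg lc; have [g' [lg' g'0 [a ga] sl]] := parallel_through (c 0) lg.
by rewrite -(slope_shift c ga) slope_sym0// sl.
Qed.

(** The case of lines through [o] extends to all lines by passing to the parallel through [o]. *)
Lemma homothety_busemann o k h c x : 0 < k ->
  (forall x y, mdist (h x) (h y) = k * mdist x y) ->
  (forall g, line g -> g 0 = o -> forall t, h (g t) = g (k * t)) ->
  line c -> busemann c (h x) = busemann c o + k * (busemann c x - busemann c o).
Proof.
move=> k0 hd hl lc; have [g [lg g0 [a ga] _]] := parallel_through o lc.
have := homothety_busemann0 x k0 hd hl lg g0.
have := busemann_line lg 0; rewrite g0 !ga oppr0 => e.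
have -> : busemann c o = - a by lra.
lra.
Qed.

(** The homothety of factor 2 about [x] is followed by that of factor 1/2 about [y]. The factors
    cancel, and what remains acts like the translation by half the vector from [x] to [y]. *)
Lemma half_translation x y : exists f f' : Y -> Y,
  [/\ cancel f f', cancel f' f, forall z z', mdist (f z) (f z') = mdist z z' &
      forall u z, line u ->
        busemann u (f z) = busemann u z + (busemann u y - busemann u x) / 2].
Proof.
have half0 : 0 < 2^-1 :> R by rewrite invr_gt0 ltr0n.
have two0 : 0 < 2 :> R by rewrite ltr0n.
have [h [h' [hK h'K _ hd hl]]] := homothety_at x two0.
have [k [k' [kK k'K _ kd kl]]] := homothety_at y half0.
exists (k \o h), (h' \o k'); split.
- exact: can_comp.
- exact: can_comp.
- by move=> z z' /=; rewrite kd hd mulKf// gt_eqF.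
- move=> u z lu /=.
  rewrite (homothety_busemann _ half0 kd kl)// (homothety_busemann _ two0 hd hl)//.
  lra.
Qed.

Lemma line_through_fiber x y : (exists2 u, line u & busemann u x != busemann u y) ->
  exists c, [/\ line c, c 0 = x &
    exists t, forall u, line u -> busemann u (c t) = busemann u y].
Proof.
move=> [u0 lu0 u0xy].
have [f [f' [fK f'K fd fb]]] := half_translation x y.
(* The two-sided orbit of [x]. As [f] is an isometry, the distance of two orbit points depends only
   on the difference of their indices, through the subadditive sequence [a]. *)
pose P (i : int) := match i with
  Posz n => iter n f x | Negz n => iter n.+1 f' x end.
have PS i : P (i + 1) = f (P i).
  case: i => [n|[|n]]; first by rewrite -PoszD addn1.
    by rewrite NegzE addNr /= f'K.
  have -> : Negz n.+1 + 1 = Negz n by rewrite !NegzE -[n.+2]addn1 PoszD; ring.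
  by rewrite [RHS]/= f'K.
have Pd i j (m : nat) : mdist (P (i + m%:Z)) (P (j + m%:Z)) = mdist (P i) (P j).
  elim: m => [|m IH]; first by rewrite !addr0.
  by rewrite -addn1 PoszD !addrA !PS fd.
pose a n := mdist x (iter n f x).
have Pa i (m : nat) : mdist (P i) (P (i + m%:Z)) = a m.
  case: i => k; first by rewrite -[Posz k]add0r addrAC Pd add0r.
  by rewrite -(Pd _ _ k.+1) addrAC NegzE addNr add0r.
have Pij i j : mdist (P i) (P j) = a `|i - j|%N.
  have [ij|/ltW ij] := leP i j.
    by rewrite distnC -(Pa i) gez0_abs ?subr_ge0// (addrC i) subrK.
  by rewrite metric_sym -(Pa j) gez0_abs ?subr_ge0// (addrC j) subrK.
have aD m n : a (m + n)%N <= a m + a n.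
  rewrite -(Pa 0 m) -(Pa 0 (m + n)%N) -(Pa m%:Z n) -PoszD.
  by rewrite !add0r; exact: metric_triangle.
have a0 n : 0 <= a n by exact: mdist_ge0.
have a1 n : a n <= n%:R * a 1%N.
  elim: n => [|n IH]; first by rewrite mul0r /a mdistxx.
  by rewrite -addn1 (le_trans (aD _ _))// natrD mulrDl mul1r lerD2r.
have [l [l0 la al]] := subadditive_growth a0 aD.
pose t n : R := (n.+1%:R)^-1.
have t0 n : 0 < t n by rewrite invr_gt0 ltr0n.
have tF : t @ F --> 0 by exact/cvg_F/cvg_harmonic.
have tK n : t n * n.+1%:R = 1 by rewrite mulVf// pnatr_eq0.
have tle1 n : t n <= 1 by rewrite invf_le1// ler1n.
have /choice[h hP] : forall n, exists h : Y -> Y, [/\ h x = x,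
    forall x y, mdist (h x) (h y) = t n * mdist x y &
    forall g, line g -> g 0 = x -> forall s, h (g s) = g (t n * s)].
  by move=> n; have [h [_ [_ _ ? ? ?]]] := homothety_at x (t0 n); exists h.
pose fl (s : R) n : int := Num.floor (s * n.+1%:R).
(* The orbit point at time about [s * n.+1], shrunk by [1 / n.+1] towards [x]. *)
pose v s n := h n (P (fl s n)).
have flE (s : R) n : s * n.+1%:R - 1 <= (fl s n)%:~R <= s * n.+1%:R.
  have := floor_itv (s * n.+1%:R); rewrite -/(fl s n) intrD => /andP[-> ].
  by move=> H; rewrite andbT; move: H; rewrite mulr1z; lra.
have vd s s' n : mdist (v s n) (v s' n) = t n * a `|fl s n - fl s' n|%N.
  by rewrite /v; have [_ -> _] := hP n; rewrite Pij.
have flN (s s' : R) n : `|s - s'| * n.+1%:R - 1 <= (`|fl s n - fl s' n|%N)%:R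
    <= `|s - s'| * n.+1%:R + 1.
  rewrite natr_absz intr_norm intrD rmorphN/=.
  have : `|s - s'| * n.+1%:R = `|s * n.+1%:R - s' * n.+1%:R|.
    by rewrite -mulrBl normrM normr_nat.
  move=> ->; have := flE s' n; have := flE s n.
  set A := s * _; set B := s' * _; set X := _%:~R; set Z := _%:~R.
  move=> /andP[? ?] /andP[? ?].
  have : `|(X - Z) - (A - B)| <= 1 by rewrite ler_norml; apply/andP; split; lra.
  move/(le_trans (ler_dist_dist _ _)); rewrite ler_norml => /andP[? ?].
  by apply/andP; split; lra.
have v0 n : v 0 n = x.
  by rewrite /v /fl mul0r floor0; have [-> _] := hP n.
have vF s s' : mdist (v s n) (v s' n) @[n --> F] --> l * `|s - s'|.
  set D := `|s - s'|; have D0 : 0 <= D by exact: normr_ge0.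
  apply/cvgrPdist_lt => e e0.
  (* This excess of the growth rate costs at most [e / 2] over the length [D]. Rounding and the
     constant [C] cost at most [t n * K], which tends to [0]. *)
  have e'0 : 0 < e / (2 * (D + 1)) by rewrite divr_gt0//; lra.
  have [C aC] := al _ e'0; set e' := e / _ in e'0 aC.
  have e'E : e' * (D + 1) = e / 2 by rewrite /e'; field; lra.
  pose K := l + e' + `|C|; have C0 := ler_norm C.
  have K0 : 0 < K by have := normr_ge0 C; rewrite /K; lra.
  near=> n; rewrite vd; have /andP[k1 k2] := flN s s' n; rewrite -/D in k1 k2.
  set k := `|_|%N in k1 k2 *.
  have tn : t n * K < e / 2.
    rewrite -ltr_pdivlMr//; near: n; apply: (cvgr_lt _ tF).
    by rewrite divr_gt0//; lra.
  have H1 : t n * (l * k%:R) <= t n * a k by rewrite ler_wpM2l// ltW.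
  have H2 : t n * a k <= t n * ((l + e') * k%:R + C) by rewrite ler_wpM2l// ltW.
  have H3 : t n * (l * (D * n.+1%:R - 1)) <= t n * (l * k%:R).
    by rewrite (ler_wpM2l (ltW (t0 n)))// ler_wpM2l.
  have H4 : t n * ((l + e') * k%:R + C) <=
      t n * ((l + e') * (D * n.+1%:R + 1) + `|C|).
    by rewrite (ler_wpM2l (ltW (t0 n)))// lerD// ler_wpM2l//; lra.
  have E3 : t n * (l * (D * n.+1%:R - 1)) = l * D - t n * l.
    transitivity (l * D * (t n * n.+1%:R) - t n * l); first by ring.
    by rewrite tK mulr1.
  have E4 : t n * ((l + e') * (D * n.+1%:R + 1) + `|C|) = (l + e') * D + t n * K.
    transitivity ((l + e') * D * (t n * n.+1%:R) + t n * K); last by rewrite tK mulr1.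
    by rewrite /K; ring.
  have : t n * l <= t n * K.
    by rewrite (ler_wpM2l (ltW (t0 n)))//; have := normr_ge0 C; rewrite /K; lra.
  rewrite ltr_norml; move: (t n * a k) (t n * l) (t n * K) H1 H2 E3 E4 H3 H4 tn.
  move=> A B G; set H := t n * _; set J := t n * _ => ? ? -> ? ? ? ? ?.
  by apply/andP; split; lra.
have /choice[g gF] : forall s, exists q : Y, v s @ F --> q.
  move=> s; apply: (bounded_cvg (p := x) (C := (`|s| + 1) * a 1%N)) => n.
  rewrite -{1}(v0 n) vd; have /andP[_] := flN 0 s n; rewrite sub0r normrN => H.
  rewrite (le_trans (ler_wpM2l (ltW (t0 n)) (a1 _)))// mulrA ler_wpM2r//.
  rewrite (le_trans (ler_wpM2l (ltW (t0 n)) H))//.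
  by rewrite mulrDr mulrCA tK !mulr1 lerD2l.
have gd s s' : mdist (g s) (g s') = l * `|s - s'|.
  exact: (cvg_eq (cvg_mdist (gF s) (gF s'))).
have g0 : g 0 = x.
  apply: mdist_positivity; apply: (cvg_eq (cvg_mdist (gF 0) (cvg_cst x))).
  rewrite (_ : (fun n => _) = cst 0); first exact: cvg_cst.
  by apply/funext => n; rewrite v0 mdistxx.
have gb u s : line u ->
    busemann u (g s) = busemann u x + s * ((busemann u y - busemann u x) / 2).
  move=> lu; set dl := _ / 2.
  have bf' z : busemann u (f' z) = busemann u z - dl.
    by rewrite -{2}(f'K z) fb// -/dl; lra.
  have bP i : busemann u (P i) = busemann u x + i%:~R * dl.
    case: i => n.
      elim: n => [|n IH]; first by rewrite mul0r addr0.
      by rewrite /= fb// -/(P n) -[n.+1]addn1 PoszD intrD IH -/dl; lra.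
    rewrite NegzE rmorphN /= -[in RHS]addn1 PoszD intrD.
    elim: n => [|n IH]; first by rewrite /= bf'; lra.
    by rewrite iterS bf' IH -[in RHS]addn1 PoszD intrD; lra.
  have flF : t n * (fl s n)%:~R @[n --> F] --> s.
    apply: (@squeeze_cvgr _ _ _ _ (fun n => s - t n) (cst s)); last exact: cvg_cst.
    - near=> n; have /andP[f1 f2] := flE s n.
      have := ler_wpM2l (ltW (t0 n)) f1; have := ler_wpM2l (ltW (t0 n)) f2.
      by rewrite mulrBr (mulrCA (t n) s) tK !mulr1 /cst/= => -> ->.
    - by rewrite -[X in _ --> X]subr0; apply: cvgB => //; exact: cvg_cst.
  apply: (cvg_eq (cvg_busemann lu (gF s))).
  rewrite (_ : (fun n => _) = fun n => busemann u x + t n * (fl s n)%:~R * dl).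
    by apply: cvgD; [|apply: cvgM]; do ?exact: cvg_cst.
  apply/funext => n; rewrite /v; have [_ hd hl] := hP n.
  by rewrite (homothety_busemann _ (t0 n) hd hl)// bP; lra.
(* With speed [0] the limit would be constant, although the Busemann function of [u0] varies along
   it. *)
have lgt0 : 0 < l.
  rewrite lt_neqAle l0 andbT; apply: contra u0xy => /eqP l00.
  have := busemann_lip_norm lu0 (g 0) (g 2); rewrite gd -l00 mul0r normr_le0.
  rewrite !gb// mul0r addr0 subr_eq0 => /eqP ->; apply/eqP; lra.
exists (fun s => g (s / l)); split.
- move=> s s'; rewrite gd -mulrBl normrM normfV (gtr0_norm lgt0).
  by field; rewrite gt_eqF.
- by rewrite mul0r.
(* Each application of [f] covers half of the way to the values at [y], so time 2 is needed, that is
   [2 * l] at unit speed. *)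
- exists (2 * l) => u lu; rewrite mulfK ?gt_eqF// gb//; lra.
Unshelve. all: by end_near. Qed.

(** * Orthonormal families of lines and coordinates *)

(** The scalar product of two directions is minus the slope, since a line has slope [- 1] along
    itself. Only the lines of index below [k] belong to the family. *)
Definition orthonormal (o : Y) k (u : nat -> R -> Y) :=
  forall i, (i < k)%N -> [/\ line (u i), u i 0 = o &
    forall j, (j < k)%N -> slope (u i) (u j) = - (i == j)%:R].

Lemma orthonormal_cons o k u v :
  orthonormal o k u -> line v -> v 0 = o ->
  (forall i, (i < k)%N -> slope (u i) v = 0) ->
  orthonormal o k.+1 (fun i => if (i < k)%N then u i else v).
Proof.
move=> ou lv v0 uv i; rewrite ltnS leq_eqVlt => /predU1P[->|ik].
  rewrite ltnn; split => // j; rewrite ltnS leq_eqVlt => /predU1P[->|jk].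
    by rewrite ltnn eqxx slope_line.
  by rewrite jk gtn_eqF// slope_sym ?uv ?oppr0//; have [] := ou _ jk.
rewrite ik; have [li i0 oi] := ou _ ik; split=> // j.
rewrite ltnS leq_eqVlt => /predU1P[->|jk]; last by rewrite jk oi.
by rewrite ltnn ltn_eqF// uv// oppr0.
Qed.

(** Otherwise choice extends families forever. In an infinite family the points [w i 1] are at
    distance 1 from [o] but at mutual distance at least 1: the Busemann function of [w i] is [- 1]
    at [w i 1] and [0] at [w j 1] for [j > i]. This excludes convergence along [F]. *)
Lemma maximal_orthonormal o g0 : line g0 -> exists k u, orthonormal o k u /\
  forall v, line v -> v 0 = o -> exists2 i, (i < k)%N & slope (u i) v != 0.
Proof.
move=> lg0; apply: contrapT => nmax.
have /choice[ext extP] : forall ku : nat * (nat -> R -> Y), exists v,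
    orthonormal o ku.1 ku.2 -> [/\ line v, v 0 = o &
      forall i, (i < ku.1)%N -> slope (ku.2 i) v = 0].
  move=> [k u]; have [ou|] := pselect (orthonormal o k u); last by exists g0.
  apply: contrapT => nv; apply: nmax; exists k, u; split=> // v lv v0.
  apply: contrapT => ni; apply: nv; exists v => _; split=> // i ik.
  by apply/eqP; apply/negPn/negP => ui; apply: ni; exists i.
pose U := fix U k := if k is k'.+1 then
  fun i => if (i < k')%N then U k' i else ext (k', U k') else fun _ => g0.
have oU k : orthonormal o k (U k).
  elim: k => [//|k IH]; have [lv v0 uv] := extP (k, U k) IH.
  exact: orthonormal_cons.
have UE i k : (i < k)%N -> U k i = U i.+1 i.
  elim: k => [//|k IH]; rewrite ltnS leq_eqVlt => /predU1P[->//|ik].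
  by rewrite [LHS]/= ik IH.
pose w i := U i.+1 i.
have lw i : line (w i) by have [] := oU _ _ (ltnSn i).
have w0 i : w i 0 = o by have [] := oU _ _ (ltnSn i).
have ow i j : (i < j)%N -> slope (w i) (w j) = 0.
  move=> ij; have [_ _ /(_ j (ltnSn j))] := oU j.+1 i (ltnW ij).
  by rewrite (UE i j.+1 (ltnW ij)) ltn_eqF// oppr0.
have [p wp] : exists p : Y, (fun i => w i 1) @ F --> p.
  by apply: (bounded_cvg (p := o) (C := 1)) => n; rewrite -(w0 n) lw sub0r normrN1.
have near_p : F [set n | mdist p (w n 1) < 1 / 2].
  by apply: metricType_numDomainType.cvgr_dist_lt => //; rewrite divr_gt0.
have [i pi] := filter_ex near_p.
have [j [/= pj ij]] := filter_ex (filterI near_p (F_oo (nbhs_infty_gt i))).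
have := busemann_lip (lw i) (w j 1) (w i 1).
rewrite busemann_line// busemann_affine// (ow _ _ ij) mul0r addr0 w0 -(w0 i).
rewrite busemann_line//; have := metric_triangle (w j 1) p (w i 1).
by rewrite (metric_sym _ p); move: pi pj => /=; lra.
Qed.

(** Two half translations make the full translation by the vector from [o] to [y]. *)
Lemma add_points o x y : exists z, forall u, line u ->
  busemann u z - busemann u o =
  (busemann u x - busemann u o) + (busemann u y - busemann u o).
Proof.
have [f [_ [_ _ _ fb]]] := half_translation o y.
by exists (f (f x)) => u lu; rewrite !fb//; lra.
Qed.

Lemma linear_combination o x k (u : nat -> R -> Y) (a : nat -> R) :
  (forall i, (i < k)%N -> line (u i) /\ u i 0 = o) ->
  exists z, forall v, line v -> busemann v z =
    busemann v x + \sum_(i < k) a i * slope v (u i).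
Proof.
elim: k => [|k IH] uo; first by exists x => v lv; rewrite big_ord0 addr0.
have [i /ltnW/uo//|z zE] := IH.
have [lu u0] := uo k (ltnSn k).
have [z' z'E] := add_points o z (u k (a k)).
exists z' => v lv; have := z'E v lv.
by rewrite zE// [busemann v (u k _)]busemann_affine// u0 big_ord_recr/=; lra.
Qed.

(** Removing from [x] its components along the family gives a point [z] with the coordinates of [o].
    If some Busemann function separated [z] from [o], the line from [o] to the fiber of [z] would be
    orthogonal to the whole family, against maximality. *)
Lemma orthonormal_expansion o k u v x : orthonormal o k u ->
  (forall v, line v -> v 0 = o -> exists2 i, (i < k)%N & slope (u i) v != 0) ->
  line v ->
  busemann v x = busemann v o -
    \sum_(i < k) (busemann (u i) x - busemann (u i) o) * slope v (u i).
Proof.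
move=> ou umax lv.
have [|z zE] := @linear_combination o x k u
    (fun i => busemann (u i) x - busemann (u i) o).
  by move=> i /ou[].
apply/eqP; rewrite -subr_eq0 opprB addrA -zE// subr_eq0.
apply/negPn/negP => zv.
have [|c [lc c0 [t tz]]] := @line_through_fiber o z.
  by exists v; rewrite // eq_sym.
have [i ik] := umax _ lc c0; have [lui ui0 oui] := ou _ ik.
have := tz _ lui; rewrite busemann_affine// c0 zE// (bigD1 (Ordinal ik))//=.
rewrite oui// eqxx mulr1n big1 => [|j ji]; last first.
  rewrite oui// eq_sym -[i]/(val (Ordinal ik)) (inj_eq val_inj) (negbTE ji).
  by rewrite oppr0 mulr0.
move=> e; have /eqP : slope (u i) c * t = 0 by lra.
rewrite mulf_eq0 => /orP[/eqP->|/eqP t0]; first by rewrite eqxx.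
by move: zv; rewrite -tz// t0 c0 eqxx.
Qed.

Lemma slope_norm_le1 g c : line g -> line c -> `|slope g c| <= 1.
Proof.
move=> lg lc; apply: le_trans (busemann_lip_norm lg _ _) _.
by rewrite lc subr0 normr1.
Qed.

Theorem euclidean_base g0 : line g0 ->
  exists2 k, (1 <= k)%N & exists pi : Y -> euclidean R k, line_fibration pi.
Proof.
move=> lg0; set o := g0 0.
have [k [u [ou umax]]] := maximal_orthonormal o lg0.
(* The sign makes [pi (u i t)] equal to [t] times the [i]-th basis vector. *)
pose pi x : euclidean R k := \row_i (busemann (u i) o - busemann (u i) x).
have lu (i : 'I_k) : line (u i) by have [] := ou _ (ltn_ord i).
have u0 (i : 'I_k) : u i 0 = o by have [] := ou _ (ltn_ord i).
have piE x y : (forall v, line v -> busemann v x = busemann v y) -> pi x = pi y.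
  by move=> e; apply/rowP => i; rewrite !mxE e.
have piP x y v : pi x = pi y -> line v -> busemann v x = busemann v y.
  move=> /rowP e lv; rewrite (orthonormal_expansion x ou umax lv).
  rewrite (orthonormal_expansion y ou umax lv).
  congr (_ - _); apply: eq_bigr => i _; have := e i; rewrite !mxE => ei.
  by congr (_ * _); lra.
(* Parseval's identity: the expansion of the Busemann function of [c'] is evaluated at [c' 1]. *)
have slope1 c : line c -> \sum_(i < k) slope (u i) c ^+ 2 = 1.
  move=> lc; have [c' [lc' c'0 [a ca] sc]] := parallel_through o lc.
  have := orthonormal_expansion (c' 1) ou umax lc'.
  have -> : busemann c' o = 0 by rewrite -c'0 busemann_line// oppr0.
  rewrite busemann_line// sub0r => /oppr_inj ->; apply: eq_bigr => i _.
  by rewrite -c'0 -/(slope _ _) [slope c' _]slope_sym// sc// expr2.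
have dpi x y c t : line c -> c 0 = x -> pi (c t) = pi y ->
    mdist (pi x) (pi y) = `|t|.
  move=> lc c0 ct; rewrite -ct [LHS]/(eucl_dist _ _) /eucl_dist.
  rewrite (eq_bigr (fun i : 'I_k => slope (u i) c ^+ 2 * t ^+ 2)) => [|i _].
    by rewrite -mulr_suml slope1// mul1r sqrtr_sqr.
  by rewrite !mxE busemann_affine// c0; ring.
have hit x y : exists c t,
    [/\ line c, c 0 = x, pi (c t) = pi y & mdist (pi x) (pi y) = `|t|].
  have [e|] := pselect (exists2 v, line v & busemann v x != busemann v y).
    have [c [lc c0 [t ct]]] := line_through_fiber e.
    by exists c, t; rewrite (dpi _ _ c t)// (piE _ _ ct).
  (* Here [x] and [y] lie in one fiber, and any line through [x] serves, with parameter [0]. *)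
  move=> ne; have [c [lc c0 _ _]] := parallel_through x lg0.
  have xy : pi x = pi y.
    apply: piE => v lv; apply/eqP; apply/negPn/negP => vxy.
    by apply: ne; exists v.
  by exists c, 0; rewrite c0 xy mdistxx normr0.
exists k; last exists pi; [|split].
- case: (k) slope1 => // /(_ _ lg0); rewrite big_ord0 => /esym/eqP.
  by rewrite oner_eq0.
- move=> b; have [|z zE] := @linear_combination o o k u
      (fun i => if insub i is Some j then (b : 'rV_k) 0 j else 0).
    by move=> i /ou[].
  exists z; apply/rowP => i; rewrite !mxE zE// (bigD1 i)//= valK big1.
    by have [_ _ ->//] := ou _ (ltn_ord i); rewrite eqxx mulr1n; lra.
  move=> j ji; have [_ _ ->//] := ou _ (ltn_ord i).
  by rewrite (inj_eq val_inj) eq_sym (negbTE ji) oppr0 mulr0.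
- exact: hit.
- move=> c x y lc; have [c' [t [lc' c'0 ct ->]]] := hit x y.
  rewrite -(piP _ _ _ ct lc) busemann_affine// c'0 opprD addrA subrr sub0r normrN.
  by rewrite normrM ler_piMl// slope_norm_le1.
- move=> c c' t t' lc lc' cc0 ctt ct0.
  have t0 : t != 0 by apply/eqP => t0; apply: ct0; rewrite t0.
  have b0 : busemann c (c' 0) = 0 by rewrite -cc0 busemann_line// oppr0.
  have b0' : busemann c' (c 0) = 0 by rewrite cc0 busemann_line// oppr0.
  have := piP _ _ _ ctt lc; have := piP _ _ _ ctt lc'.
  rewrite !busemann_line// (busemann_affine t' lc lc') (busemann_affine t lc' lc).
  rewrite b0 b0' !add0r (slope_sym lc' lc).
  set s := slope c c' => e1 e2.
  (* Evaluating each of the two Busemann functions on the other line gives [t' = - (s * t)] and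
     [t = - (s * t')], with [t] nonzero. The value [s = - 1] yields equal lines, [s = 1] opposite
     ones. *)
  have : (s + 1) * (s - 1) == 0.
    have t'E : t' = - (s * t) by lra.
    rewrite -(inj_eq (mulIf t0)) mul0r; apply/eqP.
    by move: e2; rewrite t'E; lra.
  rewrite mulf_eq0 => /orP[|] /eqP s1.
    by rewrite (@slope_N1_eq c c')// -/s; lra.
  have lr := line_revP lc'.
  rewrite (@slope_N1_eq c (line_rev c'))//.
  + apply/seteqP; split=> _ [r _ <-]; exists (- r) => //.
    by rewrite /line_rev opprK.
  + by rewrite cc0 /line_rev oppr0.
  + rewrite /slope /line_rev oppr0 b0 busemann_affine// b0 -/s; lra.
Qed.

End ptolemaic.

(** * Punctured spaces *)

Lemma ultra_fmap (T U : Type) (f : T -> U) (F : set_system T) :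
  UltraFilter F -> UltraFilter (f @ F).
Proof.
move=> FU; split; first exact: fmap_proper_filter.
move=> G GF FG; apply/seteqP; split=> [A GA|//].
have [//|FnA] := in_ultra_setVsetC (f @^-1` A) FU.
have /FG GnA : (f @ F) (~` A) by [].
by have [x []] := filter_ex (filterI GA GnA).
Qed.

Section punctured_space.
Context (R : realType) (X : topologicalType) (d : ext_metric R X) (w : X).
Hypothesis dw : remote d w.
Local Notation Y := (punctured dw).
Implicit Types x y z u : Y.

Lemma pt_inj : injective (@pt _ _ _ _ dw).
Proof. exact: val_inj. Qed.

Lemma pt_neq x : pt x != w.
Proof. exact: (svalP x). Qed.

Lemma pt_surj (a : X) : a != w -> exists x : Y, pt x = a.
Proof. by move=> aw; exists (exist _ a aw). Qed.

Lemma edist_pt x y : d (pt x) (pt y) = (mdist x y)%:E.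
Proof. by rewrite [mdist x y]/(pdist x y) /pdist fineK// edist_punctured_fin. Qed.

Lemma edist_ptw x : d (pt x) w = +oo%E.
Proof. by apply: dw; apply/eqP; exact: pt_neq. Qed.

Lemma edist_wpt x : d w (pt x) = +oo%E.
Proof. by rewrite Defs.edist_sym edist_ptw. Qed.

Lemma factor_pt x y : Defs.factor (d (pt x) (pt y)) = mdist x y.
Proof. by rewrite edist_pt. Qed.

Lemma factor_ptw x : Defs.factor (d (pt x) w) = 1.
Proof. by rewrite edist_ptw. Qed.

Lemma factor_wpt x : Defs.factor (d w (pt x)) = 1.
Proof. by rewrite edist_wpt. Qed.

Definition factorE := (factor_pt, factor_ptw, factor_wpt, mulr1, mul1r).

(** If [x = z] or [y = u] the left side vanishes; otherwise no point occurs three times and the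
    quadruple is admissible. *)
Lemma punctured_ptolemy x y z u :
  (forall x y z u : X, admissible x y z u ->
    let: (a, b, c) := crt d x y z u in [/\ a <= b + c, b <= a + c & c <= a + b]) ->
  mdist x z * mdist y u <= mdist x y * mdist z u + mdist x u * mdist y z.
Proof.
move=> pto.
have R0 : 0 <= mdist x y * mdist z u + mdist x u * mdist y z.
  by rewrite addr_ge0// mulr_ge0// mdist_ge0.
have [xz|xz] := eqVneq x z; first by rewrite {1}xz mdistxx mul0r.
have [yu|yu] := eqVneq y u; first by rewrite {1}yu mdistxx mulr0.
have := pto (pt x) (pt y) (pt z) (pt u); rewrite /crt !factorE.
case=> // a; rewrite /= addn0.
have : ~~ ((pt x == a) && (pt z == a)).
  by apply: contra xz => /andP[/eqP <- /eqP/pt_inj ->].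
have : ~~ ((pt y == a) && (pt u == a)).
  by apply: contra yu => /andP[/eqP <- /eqP/pt_inj ->].
by case: (pt x == a); case: (pt y == a); case: (pt z == a); case: (pt u == a).
Qed.

Hypothesis d_basis : basis (moebius_base d).
Hypothesis not_pair : forall a b : X, exists c, c != a /\ c != b.

(** A third point lies at finite distance from [pt x]. With two points only, both would be remote
    and the basis would contain no ball around [pt x]. *)
Lemma pt_not_remote x : ~ remote d (pt x).
Proof.
have [a [/pt_surj[y <-] yx]] := not_pair w (pt x).
by move=> /(_ (pt y) (elimN eqP yx)); rewrite edist_pt.
Qed.

Lemma nbhs_pt_ball x e : 0 < e -> nbhs (pt x) [set a | (d (pt x) a < e%:E)%E].
Proof.
move=> e0; apply: open_nbhs_nbhs; split; last by rewrite /= edistxx lte_fin.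
apply: d_basis.1; exists (pt x), e => //; left; split => //.
exact: pt_not_remote.
Qed.

Lemma nbhs_ptE x (U : set X) : nbhs (pt x) U <->
  exists2 e : R, 0 < e & forall y, mdist x y < e -> U (pt y).
Proof.
split=> [Ux|[e e0 eU]]; last first.
  apply: filterS (nbhs_pt_ball x e0) => a /=; have [->|/pt_surj[y <-]] := eqVneq a w.
    by rewrite edist_ptw.
  by rewrite edist_pt lte_fin => /eU.
have [V [[a [r r0 aV]] Vx] VU] := d_basis.2 _ _ Ux.
case: aV => [[aw VE]|VE]; move: Vx; rewrite VE /= => Vx.
  have [z za] : exists z, pt z = a.
    by apply: pt_surj; apply/eqP => aw'; apply: aw; rewrite aw'.
  move: Vx; rewrite -za edist_pt lte_fin => zx.
  exists (r - mdist z x); first by rewrite subr_gt0.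
  move=> y xy; apply: VU; rewrite VE /= -za edist_pt lte_fin.
  by have := metric_triangle z x y; lra.
(* A closed ball centred at [w] is reduced to [w], so its complement contains all of [Y]. *)
have [aw|/pt_surj[z za]] := eqVneq a w.
  by exists 1 => // y _; apply: VU; rewrite VE /= aw edist_wpt.
move: Vx; rewrite -za edist_pt lee_fin => /negP; rewrite -ltNge => zx.
exists (mdist z x - r); first by rewrite subr_gt0.
move=> y xy; apply: VU; rewrite VE /= -za edist_pt lee_fin => zy.
by have := metric_triangle z y x; rewrite (metric_sym y); lra.
Qed.

Lemma nbhs_remoteE o (U : set X) : nbhs w U <->
  U w /\ exists r : R, forall y, r < mdist o y -> U (pt y).
Proof.
split=> [Uw|[Uw [r rU]]].
  split; first exact: nbhs_singleton.
  have [V [[a [r r0 aV]] Vw] VU] := d_basis.2 _ _ Uw.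
  case: aV => [[aw VE]|VE]; move: Vw; rewrite VE /= => Vw.
    have [z za] : exists z, pt z = a.
      by apply: pt_surj; apply/eqP => aw'; apply: aw; rewrite aw'.
    by move: Vw; rewrite -za edist_ptw.
  have [aw|/pt_surj[z za]] := eqVneq a w.
    by case: Vw; rewrite aw edistxx lee_fin ltW.
  exists (r + mdist o z) => y ry; apply: VU; rewrite VE /= -za edist_pt lee_fin => zy.
  by have := metric_triangle o z y; lra.
have : nbhs w (~` [set a | (d (pt o) a <= (Num.max r 1)%:E)%E]).
  apply: open_nbhs_nbhs; split; last by rewrite /= edist_ptw.
  apply: d_basis.1; exists (pt o), (Num.max r 1); last by right.
  by rewrite lt_max ltr01 orbT.
apply: filterS => a /=; have [->//|/pt_surj[y <-]] := eqVneq a w.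
rewrite edist_pt lee_fin => /negP; rewrite -ltNge gt_max => /andP[ry _].
exact: rU.
Qed.

(** The limit in the compact space [X] is not [w], because the complement of a ball containing the
    sequence is a neighbourhood of [w]. *)
Lemma punctured_bounded_cvg (F : set_system nat) (u : nat -> Y) o C :
  UltraFilter F -> compact [set: X] -> (forall n, mdist o (u n) <= C) ->
  exists p : Y, u @ F --> p.
Proof.
move=> FU; rewrite compact_ultra => Xc uC.
have FU' := ultra_fmap (fun n => pt (u n)) FU.
have [a [_ aF]] := Xc _ FU' filterT.
have aw : a != w.
  apply/eqP => aw.
  have : nbhs a [set b | forall y, pt y = b -> C < mdist o y].
    rewrite aw; apply/(nbhs_remoteE o); split=> [y yw|].
      by have := pt_neq y; rewrite yw eqxx.
    by exists C => y Cy z /pt_inj ->.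
  move=> /aF H; have : F [set n | forall y, pt y = pt (u n) -> C < mdist o y] by [].
  by move=> /filter_ex[n /= /(_ _ erefl)]; rewrite ltNge uC.
have [x xa] := pt_surj aw; exists x.
apply/metricType_numDomainType.cvgrPdist_lt => e e0.
have : nbhs a [set b | (d a b < e%:E)%E] by rewrite -xa; exact: nbhs_pt_ball.
move=> /aF; apply: (@filterS _ F _ [set n | (d a (pt (u n)) < e%:E)%E]) => n /=.
by rewrite -xa edist_pt lte_fin.
Qed.

End punctured_space.

(** * Ptolemy circles and lines *)

Section circle_parametrization.
Context (R : realType) (p q : R).
Hypothesis pq1 : p * p + q * q = 1.

(* Inverse stereographic projection from the pole [(p, q)], in homogeneous
   coordinates: the pole is [circle_pt 1 0]. *)
Definition circle_pt (u v : R) : R * R :=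
  ((2 * (u * v) * q + (u * u - v * v) * p) / (u * u + v * v),
   ((u * u - v * v) * q - 2 * (u * v) * p) / (u * u + v * v)).

Let den_neq0 (u v : R) : (u != 0) || (v != 0) -> u * u + v * v != 0.
Proof.
move=> uv; apply/eqP => e; move: uv.
have u0 : u = 0 by nra.
have v0 : v = 0 by nra.
by rewrite u0 v0 eqxx.
Qed.

Let den1_neq0 (t : R) : t * t + 1 != 0.
Proof. by rewrite gt_eqF//; nra. Qed.

Lemma circle_pt_unit (u v : R) : (u != 0) || (v != 0) ->
  @unit_circle R (circle_pt u v).
Proof.
move=> /den_neq0 uv; rewrite /unit_circle /circle_pt /= !expr2.
by rewrite -[RHS]pq1; field.
Qed.

Let continuous_div (f g : R -> R) : continuous f -> continuous g ->
  (forall t, g t != 0) -> continuous (fun t => f t / g t).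
Proof.
move=> cf cg g0 t; apply: cvgM; first exact: cf.
by apply: cvgV; [exact: g0|exact: cg].
Qed.

Let continuous_pair (f g : R -> R) :
  continuous f -> continuous g -> continuous (fun t => (f t, g t)).
Proof.
move=> cf cg t U [[A B] /= [fA gB] AB].
suff : nbhs t [set s | U (f s, g s)] by [].
near=> s; apply: AB; split => /=; near: s; [exact: cf|exact: cg].
Unshelve. all: by end_near. Qed.

Let continuous_quadratic (a b c : R) :
  continuous (fun t : R => a * (t * t) + b * t + c).
Proof.
move=> t; apply: cvgD; last exact: cvg_cst.
apply: cvgD; (apply: cvgM; first exact: cvg_cst); last exact: cvg_id.
by apply: cvgM; exact: cvg_id.
Qed.

Lemma circle_pt_continuous : continuous (fun t => circle_pt t 1).
Proof.
have -> : (fun t => circle_pt t 1) = fun t : R =>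
    ((p * (t * t) + 2 * q * t + - p) / (1 * (t * t) + 0 * t + 1),
     (q * (t * t) + - 2 * p * t + - q) / (1 * (t * t) + 0 * t + 1)).
  by apply/funext => t; rewrite /circle_pt; congr (_ / _, _ / _); ring.
have den (t : R) : 1 * (t * t) + 0 * t + 1 != 0 by rewrite mul1r mul0r addr0.
apply: continuous_pair; apply: continuous_div => //; exact: continuous_quadratic.
Qed.

Lemma circle_pt_continuous_inv : continuous (fun t => circle_pt 1 t).
Proof.
have -> : (fun t => circle_pt 1 t) = fun t : R =>
    ((- p * (t * t) + 2 * q * t + p) / (1 * (t * t) + 0 * t + 1),
     (- q * (t * t) + - 2 * p * t + q) / (1 * (t * t) + 0 * t + 1)).
  by apply/funext => t; rewrite /circle_pt; congr (_ / _, _ / _); ring.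
have den (t : R) : 1 * (t * t) + 0 * t + 1 != 0 by rewrite mul1r mul0r addr0.
apply: continuous_pair; apply: continuous_div => //; exact: continuous_quadratic.
Qed.

Lemma circle_pt_inv t : t != 0 -> circle_pt t 1 = circle_pt 1 t^-1.
Proof.
move=> t0; have t2 := den1_neq0 t.
by congr (_, _); field; rewrite t0.
Qed.

Lemma circle_pt_pole : circle_pt 1 0 = (p, q).
Proof. by congr (_, _); field. Qed.

Lemma circle_pt_surj P : @unit_circle R P -> P <> (p, q) ->
  exists t, P = circle_pt t 1.
Proof.
case: P => a b; rewrite /unit_circle /= !expr2 => ab1 abpq.
pose B := a * p + b * q; pose A := a * q - b * p.
have AB : A * A + B * B = 1.
  by rewrite -[RHS]mulr1 -{1}ab1 -pq1 /A /B; ring.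
have aE : a = A * q + B * p by rewrite -[LHS]mulr1 -pq1 /A /B; ring.
have bE : b = B * q - A * p by rewrite -[LHS]mulr1 -pq1 /A /B; ring.
have B1 : 1 - B != 0.
  apply/eqP => B1; apply: abpq.
  have B1' : B = 1 by lra.
  have A0 : A = 0 by move: AB; rewrite B1'; nra.
  by rewrite aE bE A0 B1' !mul0r !mul1r add0r subr0.
pose t := A / (1 - B); exists t.
have tA : t * (1 - B) = A by rewrite /t mulfVK.
have tt : t * t * (1 - B) = 1 + B.
  apply: (mulIf B1); transitivity (t * (1 - B) * (t * (1 - B))); first by ring.
  by rewrite tA; lra.
have D2 : (t * t + 1) * (1 - B) = 2 by lra.
have key (c N : R) : N * (1 - B) = 2 * c -> c = N / (t * t + 1).
  move=> H; apply: (mulIf (den1_neq0 t)); rewrite mulfVK ?den1_neq0//.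
  by apply: (mulIf B1); rewrite -mulrA D2 H mulrC.
rewrite /circle_pt !mulr1; congr (_, _); apply: key.
  transitivity (2 * (t * (1 - B)) * q + (t * t * (1 - B) - (1 - B)) * p).
    by ring.
  by rewrite tA tt [in RHS]aE; ring.
transitivity ((t * t * (1 - B) - (1 - B)) * q - 2 * (t * (1 - B)) * p).
  by ring.
by rewrite tA tt [in RHS]bE; ring.
Qed.

(* Positive on the side of the pole of the chord through [circle_pt a 1] and
   [circle_pt c 1], and negative on the other side. *)
Definition chord (a c : R) (P : R * R) : R :=
  let A := P.1 * q - P.2 * p in let B := P.1 * p + P.2 * q in
  (1 + B) / 2 - (a + c) * A / 2 + a * c * (1 - B) / 2.

Lemma chord_continuous a c : continuous (chord a c).
Proof.
have -> : chord a c = fun P =>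
    ((1 - a * c) / 2 * p - (a + c) / 2 * q) * P.1 +
    ((1 - a * c) / 2 * q + (a + c) / 2 * p) * P.2 + (1 + a * c) / 2.
  by apply/funext => P; rewrite /chord /=; field.
move=> P; apply: cvgD; last exact: cvg_cst.
apply: cvgD; (apply: cvgM; first exact: cvg_cst); [exact: cvg_fst|exact: cvg_snd].
Qed.

Lemma chordE a c t : chord a c (circle_pt t 1) = (t - a) * (t - c) / (t * t + 1).
Proof.
have t2 := den1_neq0 t; rewrite /chord; set P := circle_pt t 1.
have -> : P.1 * q - P.2 * p = 2 * t / (t * t + 1).
  transitivity (2 * t * (p * p + q * q) / (t * t + 1)); last by rewrite pq1 mulr1.
  by rewrite /P /=; field.
have -> : P.1 * p + P.2 * q = (t * t - 1) / (t * t + 1).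
  transitivity ((t * t - 1) * (p * p + q * q) / (t * t + 1)); last by rewrite pq1 mulr1.
  by rewrite /P /=; field.
by field.
Qed.

Lemma chord_pole a c : chord a c (p, q) = 1.
Proof. by rewrite /chord /= (mulrC q) pq1; field. Qed.

End circle_parametrization.

(** * A Ptolemy circle through the remote point is a line *)

Section circle_line.
Context (R : realType) (X : topologicalType) (M : set (ext_metric R X)).
Context (d : ext_metric R X) (w : X).
Hypothesis Md : M d.
Hypothesis dw : remote d w.
Hypothesis d_basis : basis (moebius_base d).
Hypothesis not_pair : forall a b : X, exists c, c != a /\ c != b.
Local Notation Y := (punctured dw).

(** [s] is the signed length from [c 0]. Additivity makes [c] isometric in terms of [s];
    unboundedness at both ends and the intermediate value theorem make [s] surjective. *)
Lemma additive_path_line (c : R -> Y) :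
  (forall x y z, x < y -> y < z ->
    mdist (c x) (c z) = mdist (c x) (c y) + mdist (c y) (c z)) ->
  continuous c -> injective c ->
  (forall K, exists2 t, 0 < t & K < mdist (c 0) (c t)) ->
  (forall K, exists2 t, t < 0 & K < mdist (c 0) (c t)) ->
  exists2 g : R -> Y, line g & range g = range c.
Proof.
move=> add cc cinj posK negK.
pose D x y := mdist (c x) (c y).
have addw x y z : x <= y -> y <= z -> D x z = D x y + D y z.
  rewrite !le_eqVlt => /predU1P[->|xy]; first by rewrite /D mdistxx add0r.
  by move=> /predU1P[<-|yz]; [rewrite /D mdistxx addr0|exact: add].
pose s t := if 0 <= t then D 0 t else - D 0 t.
have sD x y : x <= y -> D x y = s y - s x.
  move=> xy; rewrite /s; case: (leP 0 x) => x0.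
    rewrite (le_trans x0 xy) (addw 0 x y)//; lra.
  case: (leP 0 y) => y0.
    by rewrite (addw x 0 y)// 1?ltW// /D (metric_sym (c x)); lra.
  have := addw x y 0 xy (ltW y0).
  rewrite /D (metric_sym (c x) (c 0)) (metric_sym (c y) (c 0)).
  lra.
have sN x y : D x y = `|s x - s y|.
  have [xy|/ltW xy] := leP x y.
    by rewrite distrC -sD// ger0_norm// mdist_ge0.
  by rewrite /D metric_sym -sD// ger0_norm// mdist_ge0.
have sc : continuous s.
  move=> t; apply/cvgrPdist_lt => e e0; near=> u; rewrite -sN /D; near: u.
  by apply: metricType_numDomainType.cvgr_dist_lt => //; exact: cc.
have surj v : exists t, s t = v.
  have [t1 t10 Kt1] := posK `|v|; have [t2 t20 Kt2] := negK `|v|.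
  have s1 : v <= s t1.
    by rewrite /s ltW//=; rewrite ltW// (le_lt_trans (ler_norm v)).
  have s2 : s t2 <= v.
    have -> : s t2 = - D 0 t2 by rewrite /s leNgt t20.
    rewrite lerNl ltW// (le_lt_trans _ Kt2)//.
    by rewrite -normrN ler_norm.
  have [|||t _ <-] := @IVT R s t2 t1 v; last by exists t.
  - by rewrite ltW// (lt_trans t20).
  - exact: continuous_subspaceT.
  - by rewrite (min_l (le_trans s2 s1)) (max_r (le_trans s2 s1)) s2.
have [h hK] := choice surj.
exists (c \o h); first by move=> x y; rewrite /= -/(D _ _) sN !hK.
apply/seteqP; split=> _ [t _ <-]; first by exists (h t).
exists (s t) => //=; apply: mdist_positivity.
by rewrite -/(D _ _) sN hK subrr normr0.
Unshelve. all: by end_near. Qed.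

(** Stereographic projection from the point of the unit circle that corresponds to [w] parametrises
    the rest of [S] by the reals. With [w] as one of the four points, the Ptolemy equality is the
    additivity of distances. *)
Lemma circle_line (S : set X) : ptolemy_circle M S -> S w ->
  exists2 g : R -> Y, line g & forall y : Y, S (pt y) <-> range g y.
Proof.
move=> [[f [g [fc gc fK gK]]] pto] Sw.
case fw : (f w) => [p q].
have pq1 : p * p + q * q = 1.
  by have [+ _] := fK w Sw; rewrite fw /unit_circle /= !expr2.
pose e t := circle_pt p q t 1.
have eU t : @unit_circle R (e t) by apply: circle_pt_unit; rewrite ?oner_eq0 ?orbT.
have gw t : g (e t) != w.
  apply/eqP => gtw; have [_] := gK _ (eU t); rewrite gtw fw => eE.
  have := chordE pq1 t t t; rewrite -/(e t) -eE chord_pole// subrr !mul0r => /eqP.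
  by rewrite oner_eq0.
have /choice[c cE] : forall t, exists y : Y, pt y = g (e t).
  by move=> t; exact: pt_surj.
have Sc t : S (pt (c t)) /\ f (pt (c t)) = e t by rewrite cE; exact: gK.
have chc a b t : chord p q a b (e t) = (t - a) * (t - b) / (t * t + 1).
  exact: chordE.
have den (x : R) : (x * x + 1 == 0) = false by rewrite gt_eqF//; nra.
have cinj : injective c.
  move=> x y cxy; have [_] := Sc x; rewrite cxy (Sc y).2 => exy.
  have := chc x x x; rewrite -exy chc subrr !mul0r => /eqP.
  rewrite !mulf_eq0 invr_eq0 den orbF.
  by rewrite orbb subr_eq0 => /eqP.
have csurj y : S (pt y) -> range c y.
  move=> Sy; have [fy gfy] := fK _ Sy.
  have [|t ft] := circle_pt_surj pq1 fy.
    rewrite -fw => fyw; have := pt_neq y.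
    by rewrite -gfy fyw (fK w Sw).2 eqxx.
  by exists t => //; apply: (pt_inj (dw := dw)); rewrite cE -gfy ft.
have add x y z : x < y -> y < z ->
    mdist (c x) (c z) = mdist (c x) (c y) + mdist (c y) (c z).
  move=> xy yz; have xz := lt_trans xy yz.
  have cneq a b : a < b -> c a != c b.
    by move=> ab; rewrite (inj_eq cinj) lt_eqF.
  have := pto d Md (pt (c x)) (pt (c y)) (pt (c z)) w.
  rewrite /crt !factorE; apply => //; do ?exact: (Sc _).1.
    rewrite /= !inE !negb_or !(inj_eq (pt_inj (dw := dw))) !pt_neq !cneq//.
  (* A connected [C] joining [c y] to [w] off [c x] and [c z] cannot exist: [chord] is nonpositive
     at [c y] and [1] at [w], hence vanishes on [C], but its only zeros on the circle correspond to
     [c x] and [c z]. *)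
  move=> [C [Cy CS Cc] Cw].
  have Lc : {within C, continuous (chord p q x z \o f)}.
    have fC : {within C, continuous f}.
      by apply: continuous_subspaceW fc => a /CS[].
    move=> a; apply: (@continuous_comp (subspace C) _ _ f (chord p q x z)).
      exact: fC.
    exact: chord_continuous.
  have /connected_intervalP Li := connected_continuous_connected Cc Lc.
  have Ly : ((chord p q x z \o f) @` C) (chord p q x z (e y)).
    by exists (pt (c y)) => //=; rewrite (Sc y).2.
  have Lw : ((chord p q x z \o f) @` C) 1.
    by exists w => //=; rewrite fw chord_pole.
  have y01 : (chord p q x z (e y) <= 0) && (0 <= 1 :> R).
    apply/andP; split; last exact: ler01.
    rewrite chc mulr_le0_ge0//; last by rewrite invr_ge0; nra.
    by rewrite mulr_ge0_le0//; lra.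
  have [a Ca] := Li _ _ Ly Lw _ y01.
  have [Sa /= nxz] := CS _ Ca; have [aw|/(pt_surj dw)[b ba]] := eqVneq a w.
    by rewrite /= aw fw chord_pole// => /eqP; rewrite oner_eq0.
  move: Sa nxz; rewrite -ba => /csurj[t _ <-] nxz.
  rewrite /= (Sc t).2 chc => /eqP; rewrite !mulf_eq0 invr_eq0 den orbF !subr_eq0.
  by move=> /orP[] /eqP tE; apply: nxz; rewrite tE; [left|right].
have cc : continuous c.
  move=> t; apply/metricType_numDomainType.cvgrPdist_lt => k k0.
  have : nbhs (g (e t)) [set a | (d (pt (c t)) a < k%:E)%E].
    by rewrite -cE; exact: nbhs_pt_ball.
  move=> /((subspace_continuousP _ _).1 gc _ (eU t)) H.
  have H' : nbhs t [set u | @unit_circle R (e u) ->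
      (d (pt (c t)) (g (e u)) < k%:E)%E] := circle_pt_continuous H.
  suff : nbhs t [set u | mdist (c t) (c u) < k] by [].
  apply: filterS H' => u /= /(_ (eU u)); by rewrite -cE edist_pt lte_fin.
(* Points near the pole are sent near [w], hence far from [c 0]. Read in the chart [circle_pt 1 t]
   at the pole, this gives the unboundedness of [c] at both ends. *)
have far K : nbhs (p, q) [set P | @unit_circle R P -> g P = w \/
    forall y, pt y = g P -> K < mdist (c 0) y].
  have pU : @unit_circle R (p, q) by rewrite -fw; exact: (fK w Sw).1.
  have gpq : g (p, q) = w by rewrite -fw; exact: (fK w Sw).2.
  have : nbhs (g (p, q)) [set a | a = w \/ forall y, pt y = a -> K < mdist (c 0) y].
    rewrite gpq; apply/(nbhs_remoteE d_basis (c 0)); split; first by left.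
    by exists K => y Ky; right => z /pt_inj ->.
  by move=> /((subspace_continuousP _ _).1 gc _ pU).
have [g' lg' rg] : exists2 g' : R -> Y, line g' & range g' = range c.
  have near0 K : exists2 k, 0 < k & forall t, t != 0 -> `|t| < k ->
      K < mdist (c 0) (c t^-1).
    have := far K; rewrite -circle_pt_pole.
    move=> /(@circle_pt_continuous_inv _ p q 0) /nbhs_ballP[k /= k0 kP].
    exists k => // t t0 tk.
    have := kP t; rewrite /ball /= sub0r normrN => /(_ tk).
    case; first by apply: circle_pt_unit; rewrite ?oner_eq0.
      by move=> gt; have := gw t^-1; rewrite /e circle_pt_inv ?invr_eq0// invrK gt eqxx.
    by apply; rewrite cE /e circle_pt_inv ?invr_eq0// invrK.
  apply: additive_path_line => // K; have [k k0 kP] := near0 K.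
  - exists (k / 2)^-1; first by rewrite invr_gt0 divr_gt0.
    by apply: kP; [rewrite gt_eqF// divr_gt0|rewrite gtr0_norm ?divr_gt0//; lra].
  - exists (- (k / 2))^-1; first by rewrite invr_lt0 oppr_lt0 divr_gt0.
    apply: kP; first by rewrite oppr_eq0 gt_eqF// divr_gt0.
    by rewrite normrN gtr0_norm ?divr_gt0//; lra.
exists g' => // y; rewrite rg; split; first exact: csurj.
by move=> [t _ <-]; exact: (Sc t).1.
Qed.

End circle_line.

Lemma within_continuousP (T U : topologicalType) (A : set T) (f : T -> U) :
  {within A, continuous f} <-> forall x, A x -> forall V, nbhs (f x) V ->
    nbhs x [set a | A a -> V (f a)].
Proof.
split=> [/subspace_continuousP fA x Ax V /(fA x Ax)//|fA].
by apply/subspace_continuousP => x Ax V /(fA x Ax).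
Qed.

(** * A line completed by the remote point is a Ptolemy circle *)

Section line_circle.
Context (R : realType) (X : topologicalType) (d : ext_metric R X) (w : X).
Hypothesis dw : remote d w.
Hypothesis d_basis : basis (moebius_base d).
Hypothesis not_pair : forall a b : X, exists c, c != a /\ c != b.
Local Notation Y := (punctured dw).
Context (g : R -> Y).
Hypothesis lg : line g.

Definition completed_line : set X := [set a | a = w \/ exists t, pt (g t) = a].
Local Notation S := completed_line.

Lemma completed_line_pt y : S (pt y) <-> range g y.
Proof.
split=> [[/eqP|[t /pt_inj <-]]|[t _ <-]]; last by right; exists t.
  by rewrite (negbTE (pt_neq y)).
by exists t.
Qed.

Lemma pt_line_continuous : continuous (fun t => pt (g t)).
Proof.
move=> t U /(nbhs_ptE d_basis not_pair)[e e0 eU].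
by apply/nbhs_ballP; exists e => //= u tu; apply: eU; rewrite lg.
Qed.

Lemma pt_lineI s t : pt (g s) = pt (g t) -> s = t.
Proof. by move=> /pt_inj /(line_inj lg). Qed.

Local Notation e t := (circle_pt 0 1 t 1 : R * R).

Let pq1 : 0 * 0 + 1 * 1 = 1 :> R. Proof. by rewrite mul0r add0r mulr1. Qed.

Let e_stereo t : (e t).2 != 1 /\ (e t).1 / (1 - (e t).2) = t.
Proof.
have t2 : t * t + 1 != 0 by rewrite gt_eqF//; nra.
have E : 1 - (e t).2 = 2 / (t * t + 1) by rewrite /circle_pt /=; field.
have E0 : 1 - (e t).2 != 0 by rewrite E mulf_neq0 ?invr_eq0// pnatr_eq0.
split; first by rewrite eq_sym -subr_eq0.
by rewrite E /circle_pt /=; field.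
Qed.

Let circle1 (P : R * R) : @unit_circle R P -> P.2 = 1 -> P = (0, 1).
Proof.
case: P => a b; rewrite /unit_circle /= => + b1; rewrite b1 => ab.
by congr (_, _); nra.
Qed.

Lemma completed_line_homeomorphic : homeomorphic S (@unit_circle R).
Proof.
have /choice[tau tauE] : forall a, exists t, S a -> a != w -> pt (g t) = a.
  move=> a; have [[->|[t <-]]|NS] := pselect (S a); last by exists 0.
    by exists 0; rewrite eqxx.
  by exists t.
have tauK t : tau (pt (g t)) = t.
  by apply: pt_lineI; apply: tauE; [right; exists t|exact: pt_neq].
pose f a : R * R := if a == w then (0, 1) else e (tau a).
pose k (P : R * R) := if P.2 == 1 then w else pt (g (P.1 / (1 - P.2))).
have fw : f w = (0, 1) by rewrite /f eqxx.
have fg t : f (pt (g t)) = e t by rewrite /f (negbTE (pt_neq _)) tauK.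
have ke t : k (e t) = pt (g t).
  by have [e1 e2] := e_stereo t; rewrite /k (negbTE e1) e2.
have kpole : k (0, 1) = w by rewrite /k eqxx.
have eU t : @unit_circle R (e t) by apply: circle_pt_unit; rewrite ?oner_eq0 ?orbT.
have surj P : @unit_circle R P -> P = (0, 1) \/ exists t, P = e t.
  move=> PU; have [->|] := pselect (P = (0, 1)); first by left.
  by move=> /(circle_pt_surj pq1 PU)[t ->]; right; exists t.
exists f, k; split.
- apply/within_continuousP => _ [->|[t <-]] U.
    rewrite fw -circle_pt_pole => /circle_pt_continuous_inv /nbhs_ballP[r /= r0 rU].
    apply/(nbhs_remoteE d_basis (g 0)); split.
      move=> _; rewrite /= fw -(circle_pt_pole (0 : R) 1).
      by apply: rU; exact: ballxx.
    exists r^-1 => y ry [/eqP|[t ty]]; first by rewrite (negbTE (pt_neq y)).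
    move: ry; rewrite -(pt_inj ty) lg sub0r normrN /= fg => rt.
    have t0 : t != 0.
      by rewrite -normr_gt0 (lt_trans _ rt)// invr_gt0.
    rewrite circle_pt_inv//; apply: rU; rewrite /ball /= sub0r normrN normfV.
    by rewrite invf_plt// posrE// normr_gt0.
  rewrite fg => /circle_pt_continuous /nbhs_ballP[r /= r0 rU].
  apply/(nbhs_ptE d_basis not_pair); exists r => // y ty [/eqP|[u uy]].
    by rewrite (negbTE (pt_neq y)).
  move: ty; rewrite -(pt_inj uy) lg /= fg => tu.
  by apply: rU.
- apply/within_continuousP => P PU U.
  have [P1|P1] := eqVneq P.2 1.
    rewrite (circle1 PU P1) kpole => /(nbhs_remoteE d_basis (g 0))[Uw [r rU]].
    (* On the circle [t = a / (1 - b)] satisfies [t * t = (1 + b) / (1 - b)]. This exceeds [r * r]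
       once [b > 0] and [1 - b < (r * r + 1)^-1], which are the two terms of the minimum. *)
    pose del := Num.min 1 (r * r + 1)^-1.
    have del0 : 0 < del by rewrite lt_min ltr01 invr_gt0/=; nra.
    apply/nbhs_ballP; exists del => // -[a b] [_ /=]; rewrite /ball /= => bd abU.
    rewrite /k /=; case: eqVneq => // b1.
    apply: rU; rewrite lg sub0r normrN.
    have b10 : 1 - b != 0 by rewrite subr_eq0 eq_sym.
    set t := a / (1 - b); have ta : t * (1 - b) = a by rewrite /t mulfVK.
    move: abU; rewrite /unit_circle /= !expr2 -ta => abU.
    have tt : t * t * (1 - b) = 1 + b by apply: (mulIf b10); lra.
    move: bd; rewrite lt_min => /andP[bd1 bd2].
    have b0 : 0 < b by move: bd1; rewrite ltr_norml; lra.
    have b1' : 0 < 1 - b by rewrite lt_neqAle eq_sym b10 /=; nra.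
    move: bd2; rewrite gtr0_norm// invf_pgt ?posrE//; last by nra.
    rewrite -div1r ltr_pdivlMr// => bd2.
    have rt : r * r < t * t.
      by rewrite -(ltr_pM2r b1') tt; lra.
    rewrite (le_lt_trans (ler_norm r))//.
    by rewrite -(ltr_pXn2r (n := 2)) ?nnegrE// !real_normK ?num_real// !expr2.
  rewrite /k (negbTE P1) => /pt_line_continuous H.
  have P10 : 1 - P.2 != 0 by rewrite subr_eq0 eq_sym.
  have cs : (fun Q : R * R => Q.1 / (1 - Q.2)) @ P --> P.1 / (1 - P.2).
    apply: cvgM; first exact: cvg_fst.
    by apply: cvgV => //; apply: cvgB; [exact: cvg_cst|exact: cvg_snd].
  have H' : nbhs P [set Q | U (pt (g (Q.1 / (1 - Q.2))))] := cs _ H.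
  have N1 : nbhs P [set Q : R * R | Q.2 != 1].
    apply/nbhs_ballP; exists `|P.2 - 1|.
      by rewrite /= normr_gt0 subr_eq0.
    move=> Q [_]; rewrite /ball /=; apply: contraTneq => ->.
    by rewrite ltxx.
  apply: filterS (filterI H' N1) => Q /= [QU Q1] _.
  by rewrite (negbTE Q1).
- move=> _ [->|[t <-]].
    by rewrite fw kpole /unit_circle /= expr0n /= expr1n add0r.
  by rewrite fg ke.
- move=> P /surj[->|[t ->]]; first by rewrite kpole fw; split => //; left.
  by rewrite ke fg; split => //; right; exists t.
Qed.

Lemma connected_component_subset (T : topologicalType) (A C : set T) a b :
  connected C -> C `<=` A -> C a -> C b -> connected_component A a b.
Proof. by move=> Cc CA Ca Cb; exists C. Qed.

Lemma connected_image_interval (h : R -> X) (I : interval R) :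
  continuous h -> connected (h @` [set` I]).
Proof.
move=> ch; apply: connected_continuous_connected.
  by apply/connected_intervalP; exact: interval_is_interval.
exact: continuous_subspaceT.
Qed.

Lemma line_joined (A : set X) (I : interval R) s t :
  (forall r, r \in I -> ~ A (pt (g r))) -> s \in I -> t \in I ->
  connected_component (S `\` A) (pt (g s)) (pt (g t)).
Proof.
move=> IA sI tI; apply: connected_component_subset.
- exact: (connected_image_interval (I := I) pt_line_continuous).
- by move=> _ [r rI <-]; split; [right; exists r|exact: IA].
- by exists s.
- by exists t.
Qed.

(* The complement of a segment is connected through [w]: it is a continuous
   image of an interval around [0] under [t |-> (x + z) / 2 + t^-1]. *)
Lemma completed_line_joined x z (C : set X) a b : x < z ->
  C = [set a | a = w \/ exists2 r, r < x \/ z < r & pt (g r) = a] ->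
  C a -> C b -> connected_component (S `\` [set pt (g x); pt (g z)]) a b.
Proof.
move=> xz CE; pose m := (x + z) / 2; pose rho := 2 / (z - x).
have rho0 : 0 < rho by rewrite divr_gt0// subr_gt0.
pose h t := if t == 0 then w else pt (g (m + t^-1)).
have ch : continuous h.
  move=> t U; have [->|t0] := eqVneq t 0.
    rewrite /h eqxx => /(nbhs_remoteE d_basis (g m))[Uw [r rU]].
    have r0 : 0 < Num.max r 1 by rewrite lt_max ltr01 orbT.
    apply/nbhs_ballP; exists (Num.max r 1)^-1; first by rewrite /= invr_gt0.
    move=> s; rewrite /ball /= sub0r normrN => sr; case: eqVneq => // s0.
    apply: rU; rewrite lg opprD addNKr normrN normfV.
    rewrite (@le_lt_trans _ _ (Num.max r 1)) ?le_max ?lexx//.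
    by rewrite -[ltLHS]invrK ltf_pV2 ?posrE ?normr_gt0 ?invr_gt0.
  rewrite /h (negbTE t0) => /pt_line_continuous H.
  have ct : (fun s => m + s^-1) @ t --> m + t^-1.
    by apply: cvgD; [exact: cvg_cst|apply: cvgV => //; exact: cvg_id].
  have H' : nbhs t [set s | U (pt (g (m + s^-1)))] := ct _ H.
  have N0 : nbhs t [set s : R | s != 0].
    apply/nbhs_ballP; exists `|t|; first by rewrite /= normr_gt0.
    move=> s; rewrite /ball /=; apply: contraTneq => ->.
    by rewrite subr0 ltxx.
  by apply: filterS (filterI H' N0) => s /= [sU s0]; rewrite (negbTE s0).
have Ch : C `<=` h @` [set` `]- rho, rho[].
  rewrite CE => _ [->|[r rxz <-]].
    by exists 0; rewrite /= ?in_itv/= ?oppr_lt0 ?rho0// /h eqxx.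
  have rm : r - m != 0 by rewrite subr_eq0; apply/eqP; rewrite /m; case: rxz; lra.
  exists (r - m)^-1; last by rewrite /h invr_eq0 (negbTE rm) invrK addrC subrK.
  rewrite /= in_itv /= -ltr_norml normfV /rho invf_plt ?posrE ?normr_gt0//.
  rewrite invf_div /m; case: rxz => rx; [rewrite ltr0_norm|rewrite gtr0_norm]; lra.
move=> /Ch Ca /Ch Cb.
apply: connected_component_subset (connected_image_interval ch) _ Ca Cb.
move=> _ [t tr <-]; rewrite /h; case: eqVneq => [_|t0].
  split; first by left.
  by case=> /eqP; rewrite eq_sym (negbTE (pt_neq _)).
split; first by right; exists (m + t^-1).
have tt : rho^-1 < `|t^-1|.
  rewrite normfV ltf_pV2 ?posrE ?normr_gt0// ltr_norml.
  by move: tr; rewrite /= in_itv.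
move: tt; rewrite invf_div => tt.
case=> /pt_lineI E; move: tt.
- rewrite (_ : t^-1 = - ((z - x) / 2)) ?normrN ?gtr0_norm ?ltxx//;
    by rewrite /m in E; lra.
- by rewrite (_ : t^-1 = (z - x) / 2) ?gtr0_norm ?ltxx//; rewrite /m in E; lra.
Qed.

(** Positive for [s] strictly between [x] and [z] and negative outside, whichever of [x] and [z] is
    smaller. *)
Let bet (x z s : R) := (s - x) * (z - s).

Let betP (x z s : R) : x < z -> 0 < bet x z s -> x < s < z.
Proof.
rewrite /bet => xz b; apply/andP; split; rewrite ltNge; apply/negP => sx; nra.
Qed.

Let nbetP (x z s : R) : x < z -> bet x z s < 0 -> s < x \/ z < s.
Proof.
rewrite /bet => xz b; have [|sx] := ltP s x; [by left|right].
by rewrite ltNge; apply/negP => sz; nra.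
Qed.

Lemma segment_joined x z s t : x != z -> 0 < bet x z s -> 0 < bet x z t ->
  connected_component (S `\` [set pt (g x); pt (g z)]) (pt (g s)) (pt (g t)).
Proof.
wlog : x z / x < z => [H xz|xz _ /(betP xz) bs /(betP xz) bt].
  move: (xz); rewrite neq_lt => /orP[/H/(_ xz)//|zx].
  by rewrite /bet mulrC -mulrNN !opprB (mulrC (t - x)) -(mulrNN (z - t)) !opprB setUC;
    apply: H => //; rewrite eq_sym.
apply: (line_joined (I := `]x, z[)); rewrite ?in_itv//= => r; rewrite in_itv /=.
by move=> /andP[xr rz] [] /pt_lineI E; move: xr rz; rewrite E ltxx.
Qed.

Lemma outside_joined x z (a b : X) : x != z ->
  (a = w \/ exists2 r, bet x z r < 0 & pt (g r) = a) ->
  (b = w \/ exists2 r, bet x z r < 0 & pt (g r) = b) ->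
  connected_component (S `\` [set pt (g x); pt (g z)]) a b.
Proof.
wlog : x z / x < z => [H xz|xz _].
  move: (xz); rewrite neq_lt => /orP[/H/(_ xz)//|zx].
  have betC r : bet x z r = bet z x r by rewrite /bet mulrC -mulrNN !opprB.
  have E c : (exists2 r, bet x z r < 0 & pt (g r) = c) =
      (exists2 r, bet z x r < 0 & pt (g r) = c).
    by apply/propext; split=> -[r rb rc]; exists r; rewrite // ?betC// -betC.
  by rewrite !E setUC; apply: H => //; rewrite eq_sym.
have out c : (c = w \/ exists2 r, bet x z r < 0 & pt (g r) = c) ->
    [set a | a = w \/ exists2 r, r < x \/ z < r & pt (g r) = a] c.
  by move=> [->|[r /(nbetP xz) rb <-]]; [left|right; exists r].
by move=> /out Ca /out Cb; exact: (completed_line_joined xz erefl Ca Cb).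
Qed.

Lemma ray_joined z s t : 0 < (s - z) * (t - z) ->
  connected_component (S `\` [set w; pt (g z)]) (pt (g s)) (pt (g t)).
Proof.
move=> st; have [sz|sz|sz] := ltgtP s z; last by move: st; rewrite sz subrr mul0r ltxx.
- have tz : t < z by nra.
  apply: (line_joined (I := `]-oo, z[)); rewrite ?in_itv//= => r; rewrite in_itv /=.
  move=> rz [/eqP|/pt_lineI E]; first by rewrite (negbTE (pt_neq _)).
  by rewrite E ltxx in rz.
- have tz : z < t by nra.
  apply: (line_joined (I := `]z, +oo[)); rewrite ?in_itv/= ?andbT// => r.
  rewrite in_itv /= andbT.
  move=> rz [/eqP|/pt_lineI E]; first by rewrite (negbTE (pt_neq _)).
  by rewrite E ltxx in rz.
Qed.

Let norm_between (a b c : R) : 0 <= (a - b) * (b - c) ->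
  `|a - c| = `|a - b| + `|b - c|.
Proof.
move=> abc; have -> : a - c = (a - b) + (b - c) by lra.
move: (a - b) (b - c) abc => p q pq.
have [p0|p0] := leP 0 p; have [q0|q0] := leP 0 q.
- by rewrite ger0_norm ?addr_ge0// !ger0_norm.
- have -> : p = 0 by nra.
  by rewrite normr0 !add0r.
- have -> : q = 0 by nra.
  by rewrite normr0 !addr0.
- by rewrite ltr0_norm ?ltr0_norm ?(ltr0_norm q0)//; lra.
Qed.

(** The difference products satisfy [(x - z) * (y - u) = (x - y) * (z - u) + (x - u) * (y - z)], and
    the hypothesis says that the two terms on the right do not have opposite signs. *)
Let norm_ptolemy (x y z u : R) : bet x z y * bet x z u <= 0 ->
  `|x - z| * `|y - u| = `|x - y| * `|z - u| + `|x - u| * `|y - z|.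
Proof.
move=> b; rewrite -!normrM.
have := @norm_between ((x - y) * (z - u)) 0 (- ((x - u) * (y - z))).
rewrite !subr0 !sub0r opprK => <-; first by congr (`|_|); ring.
by move: b; rewrite /bet; lra.
Qed.

(** By contraposition: if [y] and [u] were on one side of the pair, an arc avoiding it, possibly
    through [w], would join them. On different sides the equality is an identity between absolute
    values of real numbers. The cases tell which point, if any, is [w]. *)
Lemma completed_line_ptolemy x y z u : S x -> S y -> S z -> S u ->
  uniq [:: x; y; z; u] -> separates S x z y u ->
  let: (a, b, c) := crt d x y z u in b = a + c.
Proof.
move=> Sx Sy Sz Su; rewrite /= !inE !negb_or.
move=> /and4P[/and3P[xy xz xu] /andP[yz yu] zu _].
rewrite /separates /crt.
have gneq s t : pt (g s) != pt (g t) -> s != t by apply: contra => /eqP->.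
have bneq s t r : pt (g s) != pt (g r) -> pt (g t) != pt (g r) -> bet s t r != 0.
  by move=> /gneq sr /gneq tr; rewrite mulf_neq0// subr_eq0// eq_sym.
case: Sx xy xz xu => [->|[x' <-]] xy xz xu.
  case: Sy xy yz yu => [->|[y' <-]] xy yz yu; first by rewrite eqxx in xy.
  case: Sz xz yz zu => [->|[z' <-]] xz yz zu; first by rewrite eqxx in xz.
  case: Su xu yu zu => [->|[u' <-]] xu yu zu; first by rewrite eqxx in xu.
  rewrite !factorE !lg => sep; rewrite [RHS]addrC; apply: norm_between.
  by rewrite leNgt; apply/negP => H; apply: sep; apply: ray_joined; lra.
case: Sz xz yz zu => [->|[z' <-]] xz yz zu.
  case: Sy xy yz yu => [->|[y' <-]] xy yz yu; first by rewrite eqxx in yz.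
  case: Su xu yu zu => [->|[u' <-]] xu yu zu; first by rewrite eqxx in zu.
  rewrite !factorE !lg => sep; rewrite (distrC x' y'); apply: norm_between.
  rewrite leNgt; apply/negP => H; apply: sep; rewrite setUC; apply: ray_joined; lra.
have xz' := gneq _ _ xz.
case: Sy xy yz yu => [->|[y' <-]] xy yz yu.
  case: Su xu yu zu => [->|[u' <-]] xu yu zu; first by rewrite eqxx in yu.
  rewrite !factorE !lg => sep; rewrite [RHS]addrC (distrC z'); apply: norm_between.
  rewrite leNgt; apply/negP => H; apply: sep.
  apply: outside_joined => //; first by left.
  by right; exists u' => //; rewrite /bet; lra.
case: Su xu yu zu => [->|[u' <-]] xu yu zu.
  rewrite !factorE !lg => sep; apply: norm_between.
  rewrite leNgt; apply/negP => H; apply: sep; apply: outside_joined => //; last by left.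
  by right; exists y' => //; rewrite /bet; lra.
rewrite !factorE !lg => sep; apply: norm_ptolemy.
rewrite leNgt; apply/negP => H; apply: sep.
have by0 : bet x' z' y' != 0 by apply: bneq => //; rewrite eq_sym.
have bu0 : bet x' z' u' != 0 by apply: bneq.
move: by0; rewrite neq_lt => /orP[by0|by0].
  have bu : bet x' z' u' < 0 by nra.
  by apply: outside_joined => //; right; [exists y'|exists u'].
have bu : 0 < bet x' z' u' by nra.
exact: segment_joined.
Qed.

End line_circle.

(** * Moebius maps and space inversions *)

Section moebius.
Context (R : realType) (X : topologicalType) (M : set (ext_metric R X)).
Hypothesis M_moebius : moebius_structure M.

Lemma proj_eq_sym (p q : R * R * R) : proj_eq p q -> proj_eq q p.
Proof.
case: p => [[a b] c] [k k0 ->]; exists k^-1; rewrite ?invr_eq0//=.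
by rewrite !mulKf.
Qed.

Lemma proj_eq_trans (p q r : R * R * R) : proj_eq p q -> proj_eq q r -> proj_eq p r.
Proof.
case: p => [[a b] c] [k k0 ->] [l l0 ->]; exists (l * k); rewrite ?mulf_neq0//=.
by rewrite !mulrA.
Qed.

Lemma moebius_equivM (d d' : ext_metric R X) : M d -> M d' -> moebius_equiv d d'.
Proof.
have [d0 ->] := M_moebius => dd dd' x y z u a.
exact: proj_eq_trans (proj_eq_sym (dd _ _ _ _ a)) (dd' _ _ _ _ a).
Qed.

Lemma uniq_admissible (x y z u : X) : uniq [:: x; y; z; u] -> admissible x y z u.
Proof. by move=> un a; rewrite count_uniq_mem//; case: (_ \in _). Qed.

Lemma completed_line_circle (d : ext_metric R X) (w : X) (dw : remote d w)
    (g : R -> punctured dw) :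
  M d -> basis (moebius_base d) -> (forall a b : X, exists c, c != a /\ c != b) ->
  line g -> ptolemy_circle M (completed_line g).
Proof.
move=> Md db np lg; split; first exact: completed_line_homeomorphic.
move=> d' Md' x y z u Sx Sy Sz Su un sep.
have := completed_line_ptolemy db np lg Sx Sy Sz Su un sep.
have [k k0 ->] := moebius_equivM Md Md' (uniq_admissible un).
by rewrite /crt /= => ->; rewrite mulrDr.
Qed.

(* The ratio of the distances in [crt (x, y, z, w) = (d x y : d x z : d y z)]
   is preserved, hence a Moebius map is a homothety between punctured spaces. *)
Lemma moebius_homothety (d d' : ext_metric R X) (w w' : X) (dw : remote d w)
    (dw' : remote d' w') (f : X -> X) :
  M d -> M d' -> (exists x y : punctured dw, x != y) ->
  moebius_map M f -> f w = w' ->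
  exists2 a, 0 < a & forall (x y : punctured dw) (x' y' : punctured dw'),
    pt x' = f (pt x) -> pt y' = f (pt y) -> mdist x' y' = a * mdist x y.
Proof.
move=> Md Md' [p [q pq]] [finj fcrt] fw.
have /choice[h hE] : forall x : punctured dw,
    exists x' : punctured dw', pt x' = f (pt x).
  move=> x; apply: pt_surj; rewrite -fw (inj_eq finj); exact: pt_neq.
have hinj x y : x != y -> h x != h y.
  apply: contra => /eqP hxy; apply/eqP/(@pt_inj _ _ _ _ dw)/finj.
  by rewrite -!hE hxy.
have tri x y z : uniq [:: x; y; z] -> exists k,
    [/\ mdist (h x) (h y) = k * mdist x y, mdist (h x) (h z) = k * mdist x z &
        mdist (h y) (h z) = k * mdist y z].
  move=> un; have un3 : uniq [:: pt x; pt y; pt z; w].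
    move: un; rewrite /= !inE !(inj_eq (@pt_inj _ _ _ _ dw)) !negb_or !pt_neq.
    by case: (x != y); case: (x != z); case: (y != z).
  have := fcrt _ Md _ _ _ _ (uniq_admissible un3).
  have un3' : uniq [:: f (pt x); f (pt y); f (pt z); f w].
    exact: etrans (map_inj_uniq finj [:: pt x; pt y; pt z; w]) un3.
  move=> /proj_eq_trans/(_ (moebius_equivM Md Md' (uniq_admissible un3'))).
  by rewrite fw -!hE /crt !factorE => -[k _ [-> -> ->]]; exists k.
(* The factor is read off the pair [p], [q]. Triples sharing a pair have the same factor, which
   spreads it to the pairs containing [p] and from there to all pairs. *)
have [a a0 aE] : exists2 a, 0 < a & mdist (h p) (h q) = a * mdist p q.
  exists (mdist (h p) (h q) / mdist p q).
    by rewrite divr_gt0// mdist_gt0// hinj.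
  by rewrite divfK// gt_eqF// mdist_gt0.
have an0 := lt0r_neq0 a0.
have aP x : mdist (h p) (h x) = a * mdist p x.
  have [->|xp] := eqVneq x p; first by rewrite !mdistxx mulr0.
  have [->//|xq] := eqVneq x q.
  have [|k [e1 -> _]] := tri p q x.
    by rewrite /= !inE negb_or pq eq_sym xp eq_sym xq.
  congr (_ * _); apply: (mulIf (_ : mdist p q != 0)); last by rewrite -e1.
  by rewrite gt_eqF// mdist_gt0.
exists a => // x y x' y'; rewrite -!hE.
move=> /(@pt_inj _ _ _ _ dw')-> /(@pt_inj _ _ _ _ dw')->.
have [->|xp] := eqVneq x p; first exact: aP.
have [->|yp] := eqVneq y p; first by rewrite metric_sym aP// metric_sym.
have [->|xy] := eqVneq x y; first by rewrite !mdistxx mulr0.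
have [|k [e1 _ ->]] := tri p x y.
  by rewrite /= !inE negb_or xy eq_sym xp eq_sym yp.
congr (_ * _); apply: (mulIf (_ : mdist p x != 0)); last by rewrite -e1 aP.
by rewrite gt_eqF// mdist_gt0 eq_sym.
Qed.

Hypothesis I : forall (w w' : X) (S : set X), w <> w' -> sphere_between M w w' S ->
  exists! phi : X -> X, space_inversion M w w' S phi.

(** For a metric with [w] remote the first two entries of the triple are the distances of the two
    points to [o], so a sphere between [w] and [o] lies on a metric sphere about [o]. *)
Lemma sphere_through (w o x : X) : x != w -> x != o -> w != o -> exists S,
  [/\ sphere_between M w o S, S x &
      forall d (dw : remote d w) (p p' o' : punctured dw), M d -> pt o' = o ->
        pt p = x -> S (pt p') -> mdist p o' = mdist p' o'].
Proof.
move=> xw xo wo.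
have xwo : x \notin [:: w; o] by rewrite !inE negb_or xw xo.
exists [set y | y \notin [:: w; o] /\ sphere_rel M w o x y]; split.
- by exists x.
- split=> // d Md; pose k := Defs.factor (d w x) * Defs.factor (d x o).
  have k0 : 0 < k by rewrite mulr_gt0// factor_gt0// eq_sym.
  exists (k^-1 * (Defs.factor (d w o) * Defs.factor (d x x))), k^-1.
    by rewrite invr_eq0 gt_eqF.
  by rewrite /crt /= -/k mulVf// gt_eqF.
- move=> d dw p p' o' Md <- <- [_ /(_ d Md)[t [k k0]]].
  rewrite /crt !factorE => -[e1 e2 _]; apply: (mulfI k0).
  by rewrite -e2 -e1.
Qed.

(** * Metric inversions induced by space inversions *)

Section inversion.
Context (d : ext_metric R X) (w : X) (dw : remote d w).
Hypothesis Md : M d.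
Hypothesis d_basis : basis (moebius_base d).
Hypothesis not_pair : forall a b : X, exists c, c != a /\ c != b.
Local Notation Y := (punctured dw).

(** The sphere through [x0] is invariant, so [x0] keeps its distance to [o]; this fixes the product
    of distances at [x0], and cross-ratios with [w] and [o] exchanged spread it to all points. A
    line through [o] completes to an invariant circle, which gives its image up to a sign. *)
Lemma inversion_through (o x0 : Y) (r : R) : x0 != o -> r = mdist x0 o * mdist x0 o ->
  exists phi, is_inversion o r phi.
Proof.
move=> x0o rE; have D0 : 0 < mdist x0 o by rewrite mdist_gt0.
have ptI x y : (pt x == pt y) = (x == y) := inj_eq (@pt_inj _ _ _ _ dw) x y.
have px0o : pt x0 != pt o by rewrite ptI.
have wNo : w != pt o by rewrite eq_sym pt_neq.
have [S [Ssph Sx0 SE]] := sphere_through (pt_neq x0) px0o wNo.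
have wo : w <> pt o by apply/eqP; rewrite eq_sym pt_neq.
have [f [[[finj fcrt] fK ffix fw [fS fcirc]] _]] := I wo Ssph.
have fo : f (pt o) = w by rewrite -fw fK.
have /choice[phi phiE] : forall x, exists y : Y, x != o -> pt y = f (pt x).
  move=> x; have [xo|xo] := eqVneq x o; first by exists x.
  have [|y <-] := @pt_surj _ _ _ _ dw (f (pt x)); last by exists y.
  by apply: contra xo => /eqP; rewrite -[X in _ = X]fo => /finj/eqP; rewrite ptI.
have phio x : x != o -> phi x != o.
  by move=> xo; rewrite -ptI phiE// -fw (inj_eq finj) pt_neq.
have phiK x : x != o -> phi (phi x) = x.
  by move=> xo; apply: (@pt_inj _ _ _ _ dw); rewrite !phiE ?phio// fK.
have key x y : x != o -> y != o -> x != y -> exists k,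
    [/\ mdist (phi x) (phi y) = k * mdist x y,
        mdist (phi y) o = k * mdist x o & mdist (phi x) o = k * mdist y o].
  move=> xo yo xy.
  have un : uniq [:: pt x; pt y; pt o; w].
    rewrite /= !inE !ptI !negb_or !pt_neq xo yo xy//.
  have [k _] := fcrt _ Md _ _ _ _ (uniq_admissible un).
  by rewrite fw fo -!phiE// /crt !factorE => -[-> -> ->]; exists k.
have phix0 : mdist (phi x0) o * mdist x0 o = r.
  rewrite rE; congr (_ * _); apply/esym/(SE d dw x0) => //.
  by rewrite phiE// -fS; exists (pt x0).
have phir x : x != o -> mdist (phi x) o * mdist x o = r.
  move=> xo; have [->//|xx0] := eqVneq x x0.
  have [k [_ e1 e2]] := key x x0 xo x0o xx0.
  by rewrite -phix0 e1 e2; ring.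
have phid x y : x != o -> y != o ->
    mdist (phi x) (phi y) * (mdist x o * mdist y o) = r * mdist x y.
  move=> xo yo; have [->|xy] := eqVneq x y; first by rewrite !mdistxx mul0r mulr0.
  have [k [-> _ e2]] := key x y xo yo xy.
  by rewrite -(phir x xo) e2; ring.
exists phi; split=> // [x xo|g lg g0 t t0]; first by split; [exact: phio|exact: phir].
have gto s : s != 0 -> g s != o by move=> s0; rewrite -g0 line_neq.
have gr s : mdist (g s) o = `|s| by rewrite -g0 lg subr0.
have cg := completed_line_circle Md d_basis not_pair lg.
have tauP s : s != 0 -> exists2 s', phi (g s) = g s' & `|s'| * `|s| = r.
  move=> s0; have : completed_line g (pt (phi (g s))).
    rewrite phiE ?gto// -(fcirc _ cg); last by right; exists 0; rewrite g0.
      by exists (pt (g s)) => //; right; exists s.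
    by left.
  move=> /completed_line_pt[s' _ e]; exists s' => //.
  by rewrite -!gr e phir// gto.
have r0 : 0 < r by rewrite rE mulr_gt0.
have [t1 t10 t1r] : exists2 t1, t1 != 0 & t1 * t1 = r.
  by exists (mdist x0 o) => //; rewrite gt_eqF.
(* As [t1 * t1 = r], the only other candidate is [g t1] itself, which would be a fixed point. *)
have phit1 : phi (g t1) = g (- t1).
  have [s' e s'r] := tauP t1 t10; rewrite e; congr g.
  have : `|s'| * `|t1| == `|t1| * `|t1| by rewrite s'r -normrM t1r gtr0_norm.
  rewrite (inj_eq (mulIf _)) ?normr_eq0// eqr_norm2 => /orP[/eqP s't|/eqP//].
  have := ffix (pt (g t1)); rewrite -phiE ?gto// e s't.
  by move=> /(_ erefl).
have [s' e s'r] := tauP t t0; rewrite e; congr g.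
have : `|s' * t| == `|r| by rewrite normrM s'r gtr0_norm.
rewrite eqr_norm2 => /orP[/eqP s't|/eqP s't]; last first.
  by apply: (mulIf t0); rewrite s't divfK.
(* The wrong sign [s' * t = r], compared with the image of [g t1], would give [t1 + t] and [t - t1]
   the same absolute value, although [t] and [t1] are nonzero. *)
have := phid (g t) (g t1) (gto _ t0) (gto _ t10).
rewrite e phit1 !lg !gr opprK -!normrM.
have -> : (s' + t1) * (t * t1) = r * (t1 + t).
  by rewrite mulrA mulrDl s't -t1r; ring.
rewrite normrM (gtr0_norm r0) => /(mulfI (lt0r_neq0 r0)) /eqP.
rewrite eqr_norm2 => /orP[] /eqP tt.
  by case/eqP: t10; lra.
by case/eqP: t0; lra.
Qed.

(** Along [g] the distance to [o] takes every value from some [D] on. A smaller radius [r] is the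
    image of [D * D / r] under the inversion of squared radius [D * D]. *)
Lemma sphere_nonempty (g : R -> Y) (o : Y) (r : R) : line g -> 0 < r ->
  exists x : Y, mdist x o = r.
Proof.
move=> lg r0.
have [a ao] : exists a, g a != o.
  have [g0o|] := eqVneq (g 0) o; last by exists 0.
  by exists 1; rewrite -g0o line_neq// oner_eq0.
pose D := mdist (g a) o; have D0 : 0 < D by rewrite mdist_gt0.
have far s : D <= s -> exists x, mdist x o = s.
  move=> Ds; pose h t := mdist (g (t + a)) o.
  have hc : continuous h.
    move=> t; apply/cvgrPdist_lt => e e0; near=> u.
    have tu : `|t - u| < e by near: u; apply: cvgr_dist_lt => //; exact: cvg_id.
    apply: le_lt_trans tu; rewrite /h.
    have := metric_triangle (g (t + a)) (g (u + a)) o.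
    have := metric_triangle (g (u + a)) (g (t + a)) o.
    rewrite (metric_sym (g (u + a)) (g (t + a))) !lg opprD addrACA subrr addr0 => ? ?.
    by rewrite ler_norml; apply/andP; split; lra.
  have h0 : h 0 = D by rewrite /h add0r.
  have hT : s <= h (s + D).
    have := metric_triangle (g (s + D + a)) o (g a).
    rewrite lg addrK (metric_sym o) -/D -/(h (s + D)) gtr0_norm; lra.
  have [|||t _ <-] := @IVT R h 0 (s + D) s; last by exists (g (t + a)).
  - by lra.
  - exact: continuous_subspaceT.
  - by rewrite h0 (min_l (le_trans Ds hT)) (max_r (le_trans Ds hT)) Ds.
have [Dr|rD] := leP D r; first exact: far.
have [phi [phio _ _ _]] := inversion_through ao erefl.
have DD : D <= D * D / r by rewrite ler_pdivlMr// ler_pM2l// ltW.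
have [x xo] := far _ DD; exists (phi x).
have D20 : 0 < D * D / r by rewrite divr_gt0// mulr_gt0.
have xNo : x != o by rewrite -mdist_gt0 xo.
apply: (mulIf (lt0r_neq0 D20)); rewrite -{1}xo (phio x xNo).2 -/D.
by field; rewrite gt_eqF.
Unshelve. all: by end_near. Qed.

Lemma punctured_inversion (g : R -> Y) (o : Y) (r : R) : line g -> 0 < r ->
  exists phi, @is_inversion R Y o r phi.
Proof.
move=> lg r0; have s0 : 0 < Num.sqrt r by rewrite sqrtr_gt0.
have [x xo] := sphere_nonempty o lg s0.
apply: (@inversion_through o x); first by rewrite -mdist_gt0 xo.
by rewrite xo -expr2 sqr_sqrtr// ltW.
Qed.

End inversion.

Lemma moebius_line (d d' : ext_metric R X) (w w' : X) (dw : remote d w)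
    (dw' : remote d' w') (f : X -> X) (g : R -> punctured dw) :
  M d -> M d' -> moebius_map M f -> f w = w' -> line g ->
  exists g' : R -> punctured dw', line g'.
Proof.
move=> Md Md' fM fw lg.
have two : exists x y : punctured dw, x != y.
  by exists (g 0), (g 1); rewrite line_neq// eq_sym oner_eq0.
have [a a0 aP] := moebius_homothety dw' Md Md' two fM fw.
have /choice[h hE] : forall x : punctured dw, exists y : punctured dw', pt y = f (pt x).
  by move=> x; apply: pt_surj; rewrite -fw (inj_eq fM.1) pt_neq.
exists (fun t => h (g (t / a))) => s t.
rewrite (aP _ _ _ _ (hE _) (hE _)) lg -mulrBl normrM normfV (gtr0_norm a0).
by rewrite mulrC divfK// gt_eqF.
Qed.

(** A space inversion exchanging [w] and [w'] is a homothety between the punctured spaces. For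
    [w = w'] the identity plays this role between the two metrics. *)
Lemma line_transport (d d' : ext_metric R X) (w w' : X) (dw : remote d w)
    (dw' : remote d' w') (g : R -> punctured dw) :
  M d -> M d' -> (forall a b : X, exists c, c != a /\ c != b) -> line g ->
  exists g' : R -> punctured dw', line g'.
Proof.
move=> Md Md' np lg; have [ww'|ww'] := eqVneq w w'.
  apply: (moebius_line (f := id) dw' Md Md' _ ww' lg).
  by split=> // e _ x y z u _; exists 1; rewrite ?oner_eq0//= !mul1r.
have [c [cw cw']] := np w w'.
have [S [Ssph _ _]] := sphere_through cw cw' ww'.
have [f [[fM _ _ fw _] _]] := I (elimN eqP ww') Ssph.
exact: moebius_line fM fw lg.
Qed.

End moebius.

Lemma circle_not_pair (R : realType) (X : topologicalType) (S : set X) (a b : X) :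
  homeomorphic S (@unit_circle R) -> exists c, c != a /\ c != b.
Proof.
move=> [f [g [_ _ _ gK]]].
have U1 : @unit_circle R (1, 0) by rewrite /unit_circle /= expr1n expr0n addr0.
have U2 : @unit_circle R (0, 1) by rewrite /unit_circle /= expr1n expr0n add0r.
have U3 : @unit_circle R (-1, 0) by rewrite /unit_circle /= sqrrN expr1n expr0n addr0.
have gneq P Q : @unit_circle R P -> @unit_circle R Q -> P != Q -> g P != g Q.
  move=> /gK[_ PE] /gK[_ QE]; apply: contra => /eqP gPQ.
  by rewrite -PE gPQ QE.
have g12 : g (1, 0) != g (0, 1).
  by apply: gneq => //; rewrite xpair_eqE oner_eq0.
have g13 : g (1, 0) != g (-1, 0).
  by apply: gneq => //; rewrite xpair_eqE negb_and; apply/orP; left; apply/eqP; lra.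
have g23 : g (0, 1) != g (-1, 0).
  by apply: gneq => //; rewrite xpair_eqE negb_and oner_eq0 orbT.
apply: contrapT => nc.
have nab P : g P = a \/ g P = b.
  have [ga|ga] := eqVneq (g P) a; first by left.
  have [gb|gb] := eqVneq (g P) b; first by right.
  by case: nc; exists (g P).
by move: g12 g13 g23; case: (nab (1, 0)) => ->; case: (nab (0, 1)) => ->;
  case: (nab (-1, 0)) => ->; rewrite ?eqxx.
Qed.

Unset Implicit Arguments.

Theorem theorem3p4 (R : realType) (X : topologicalType)
    (M : set (ext_metric R X))
    (M_moebius : moebius_structure M)
    (M_topology : moebius_topology M)
    (X_compact : compact [set: X])
    (M_ptolemy : ptolemy_space M)
    (E : exists s, ptolemy_circle M s)
    (I : forall (w w' : X) (S : set X), w <> w' -> sphere_between M w w' S ->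
      exists! phi : X -> X, space_inversion M w w' S phi)
    (d : X -> ext_metric R X) (Md : forall w, M (d w))
    (dw : forall w, remote (d w) w) :
  exists (B : X -> metricType R) (pi : forall w, punctured (dw w) -> B w),
    [/\ forall w, [/\ lipschitz1 (pi w), submetry (pi w) &
          exists2 k : nat, (1 <= k)%N & isometric (B w) (euclidean R k)],
        forall (phi : X -> X) (w w' : X),
          moebius_automorphism M phi -> phi w = w' ->
          exists2 phib : B w -> B w', homothety phib &
            forall (x : punctured (dw w)) (y : punctured (dw w')),
              pt y = phi (pt x) -> pi w' y = phib (pi w x) &
        forall (w : X) (b : B w) (x : punctured (dw w)),
          let F := pi w @^-1` [set b] in
          ~ F x ->
          exists! l : set (punctured (dw w)),
            [/\ ptolemy_line M l, l x & l `&` F !=set0]].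
Proof.
have [s s_circle] := E.
have np a b : exists c, c != a /\ c != b := circle_not_pair a b s_circle.1.
have db w : basis (moebius_base (d w)) := M_topology _ (Md w).
have lines w : exists g : R -> punctured (dw w), line g.
  have [f [g [_ _ _ gK]]] := s_circle.1.
  have U : @unit_circle R (0, 1) by rewrite /unit_circle /= expr1n expr0n add0r.
  (* The given circle may miss [w]: the line is found in the space punctured at the point [g (0, 1)]
     of the circle, then transported to [w]. *)
  have [h lh _] := circle_line (Md _) (dw _) (db _) np s_circle (gK _ U).1.
  exact: (line_transport M_moebius I (dw w) (Md _) (Md w) np lh).
have [F [FU Foo]] := ultraFilterLemma (eventually_filter : ProperFilter \oo).
have fib w : exists kpi : {k : nat & punctured (dw w) -> euclidean R k},
    (1 <= projT1 kpi)%N /\ line_fibration (projT2 kpi).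
  have [g lg] := lines w.
  have bc (u : nat -> punctured (dw w)) p C : (forall n, mdist p (u n) <= C) ->
      exists q : punctured (dw w), u @ F --> q.
    exact: punctured_bounded_cvg.
  have pto (x y z u : punctured (dw w)) :
      mdist x z * mdist y u <= mdist x y * mdist z u + mdist x u * mdist y z.
    by apply: punctured_ptolemy; exact: M_ptolemy.
  have inv (o : punctured (dw w)) (r : R) := punctured_inversion M_moebius I
    (Md w) (db w) np o (r := r) lg.
  have [k k1 [pi pifib]] := euclidean_base Foo bc pto inv lg.
  by exists (existT _ k pi).
pose kpi w := projT1 (cid (fib w)).
have kpiP w : (1 <= projT1 (kpi w))%N /\ line_fibration (projT2 (kpi w)).
  exact: projT2 (cid (fib w)).
exists (fun w => euclidean R (projT1 (kpi w))), (fun w => projT2 (kpi w)); split.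
- move=> w; have [k1 pifib] := kpiP w; split.
  + exact: fibration_lipschitz1.
  + exact: fibration_submetry.
  + by exists (projT1 (kpi w)) => //; exists id => //; exists id.
- move=> phi w w' [phibij phiM] phiw.
  have [k1 pifib] := kpiP w; have [k1' pifib'] := kpiP w'.
  have [g lg] := lines w.
  have two : exists x y : punctured (dw w), x != y.
    by exists (g 0), (g 1); rewrite line_neq// eq_sym oner_eq0.
  have [a a0 aP] := moebius_homothety M_moebius (dw w') (Md w) (Md w') two phiM phiw.
  have [psi phiK psiK] := phibij.
  have /choice[f fE] : forall x : punctured (dw w),
      exists y : punctured (dw w'), pt y = phi (pt x).
    by move=> x; apply: pt_surj; rewrite -phiw (inj_eq phiM.1) pt_neq.
  have /choice[f' f'E] : forall y : punctured (dw w'),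
      exists x : punctured (dw w), pt x = psi (pt y).
    move=> y; apply: pt_surj; rewrite -(inj_eq phiM.1) psiK phiw; exact: pt_neq.
  have fK : cancel f f'.
    by move=> x; apply: (@pt_inj _ _ _ _ (dw w)); rewrite f'E fE phiK.
  have f'K : cancel f' f.
    by move=> y; apply: (@pt_inj _ _ _ _ (dw w')); rewrite fE f'E psiK.
  have fd x y : mdist (f x) (f y) = a * mdist x y by apply: aP.
  have [h hh hE] := fibration_homothety pifib pifib' a0 fK f'K fd.
  exists h => // x y yx; rewrite -hE; congr (projT2 (kpi w') _).
  by apply: (@pt_inj _ _ _ _ (dw w')); rewrite fE.
- move=> w b x Fb nFx; have [k1 pifib] := kpiP w.
  have [y yb] := fibration_surj pifib b.
  have [c [t [lc c0 ct _]]] := fibration_line pifib x y.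
  exists (range c); split.
    split.
    - exists (completed_line c); split.
      + exact: (completed_line_circle M_moebius (Md w) (db w) np lc).
      + by left.
      + by apply/seteqP; split=> z /(completed_line_pt c).
    - by exists 0.
    - by exists (c t); split; [exists t|rewrite /Fb /= ct].
  (* A competing Ptolemy line is parametrised and shifted so as to start at [x]; it meets the fiber
     at [t2 - t1], and [fibration_uniq] compares it with [c]. *)
  move=> l [[S [Scirc Sw ->]] Sx [z [Sz zb]]].
  have [g lg Sg] := circle_line (Md w) (dw w) (db w) np Scirc Sw.
  have [t1 _ gt1] := (Sg x).1 Sx; have [t2 _ gt2] := (Sg z).1 Sz.
  have lg' := line_shift t1 lg.
  have g'0 : c 0 = g (0 + t1) by rewrite add0r gt1.
  have g'z : g (t2 - t1 + t1) = z by rewrite subrK.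
  rewrite (fibration_uniq pifib (t := t) (t' := t2 - t1) lc lg' g'0).
  - apply/seteqP; split=> v.
      by move=> [r _ <-]; apply/Sg; exists (r + t1).
    by move=> /Sg[r _ <-]; exists (r - t1); rewrite // subrK.
  - by rewrite ct yb g'z zb.
  - by rewrite ct yb c0 => xb; apply: nFx; rewrite /Fb /= xb.
Qed.
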